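(* Every integral generalized permutahedron $P\subset\mathbb{R}^n$ has a regular unimodular triangulation.
   Context: Let $e_1,\dots,e_n$ be the standard basis of $\mathbb{R}^n$ and, for $S\subseteq[n]=\{1,\dots,n\}$, write $x_S=\sum_{i\in S}x_i$. A generalized permutahedron is a polytope $P\subset\mathbb{R}^n$ satisfying any one of the following equivalent conditions: (1) all edge directions of $P$ are of the form $e_i-e_j$; (2) the normal fan of $P$ is a coarsening of the braid arrangement; (3) $P$ is defined by the inequalities $x_S\le f(S)$, where $f$ is a submodular real-valued function on the subsets of $[n]$, together with the single equation $x_{[n]}=f([n])$. It is integral if all its vertices have integer coordinates. A subdivision of a polytope $P$ is a finite collection $\mathcal{S}=\{P_1,\dots,P_k\}$ of polytopes such that (1) $\bigcup_i P_i=P$; (2) every face of each $P_i$ belongs to $\mathcal{S}$; (3) for all $i,j$, $P_i\cap P_j$ is a face of both $P_i$ and $P_j$. A triangulation is a subdivision all of whose members are simplices. Given a finite subset $S\subset P$ containing the vertices of $P$ (it may contain other points of $P$ as well) and a function $f:S\to\mathbb{R}$, the subdivision of $P$ induced by $f$ is the one formed by projecting to $P$ (forgetting the last coordinate) the lower faces of $\operatorname{conv}\{(x,f(x)):x\in S\}\subset\mathbb{R}^{n+1}$, where a lower face is a face on which some linear functional with positive last coefficient is minimized. A subdivision is regular if it is induced by some such function $f$. For a set $T\subseteq\mathbb{R}^n$, $\operatorname{lin}(T)$ denotes the linear subspace parallel to, and of the same dimension as, the affine span of $T$. A simplex $T$ with vertices in $\mathbb{Z}^n$ is unimodular if a maximal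 linearly independent set of its edge vectors (differences of two vertices) forms a lattice basis of $\operatorname{lin}(T)\cap\mathbb{Z}^n$ (equivalently, it has normalized volume 1). A triangulation is unimodular if all its simplices are unimodular. *)

(* Defs.v *)
From HB Require Import structures.
From mathcomp Require Import all_boot all_order all_algebra.
From mathcomp Require Import all_classical all_reals.

Set Implicit Arguments.
Unset Strict Implicit.
Unset Printing Implicit Defensive.

Import Order.TTheory GRing.Theory Num.Theory.

Local Open Scope classical_set_scope.
Local Open Scope ring_scope.

Definition affine_hull (R : realType) n (A : set 'rV[R]_n) : set 'rV[R]_n :=
  [set x | exists k (p : 'I_k -> 'rV[R]_n) (c : 'I_k -> R),
     [/\ forall i, A (p i), \sum_i c i = 1 & x = \sum_i c i *: p i]].

Definition convex_hull (R : realType) n (A : set 'rV[R]_n) : set 'rV[R]_n :=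
  [set x | exists k (p : 'I_k -> 'rV[R]_n) (c : 'I_k -> R),
     [/\ forall i, A (p i), forall i, 0 <= c i, \sum_i c i = 1
       & x = \sum_i c i *: p i]].

(* The empty set is a polytope, namely the hull of no points. *)
Definition is_polytope (R : realType) n (P : set 'rV[R]_n) : Prop :=
  exists A : set 'rV[R]_n, finite_set A /\ P = convex_hull A.

(* A linear functional on row vectors is a column vector c : x |-> x *m c. *)
Definition argmin_set (R : realType) n (c : 'cV[R]_n) (P : set 'rV[R]_n) :
    set 'rV[R]_n :=
  [set x | P x /\ forall y, P y -> (x *m c) 0 0 <= (y *m c) 0 0].

(* The empty set is a face of every polytope; P itself is the face c = 0. *)
Definition is_face (R : realType) n (P F : set 'rV[R]_n) : Prop :=
  F = set0 \/ exists c : 'cV[R]_n, F = argmin_set c P.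

Definition is_vertex (R : realType) n (P : set 'rV[R]_n) (v : 'rV[R]_n) :
    Prop :=
  is_face P [set v].

Definition int_vector (R : realType) n (v : 'rV[R]_n) : Prop :=
  forall i, v 0 i \is a Num.int.

Definition integral_polytope (R : realType) n (P : set 'rV[R]_n) : Prop :=
  forall v, is_vertex P v -> int_vector v.

Definition submodular (R : realType) n (f : {set 'I_n} -> R) : Prop :=
  forall A B : {set 'I_n}, f (A :|: B) + f (A :&: B) <= f A + f B.

Definition generalized_permutahedron (R : realType) n (P : set 'rV[R]_n) :
    Prop :=
  is_polytope P /\
  exists f : {set 'I_n} -> R,
    submodular f /\
    P = [set x : 'rV[R]_n |
          (forall S : {set 'I_n}, \sum_(i in S) x 0 i <= f S) /\
          \sum_i x 0 i = f [set: 'I_n]%SET].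

(* As the empty set is a face of every polytope, it belongs to every nonempty
   subdivision. *)
Definition is_subdivision (R : realType) n (P : set 'rV[R]_n)
    (S : set (set 'rV[R]_n)) : Prop :=
  [/\ finite_set S,
      forall Q, S Q -> is_polytope Q,
      \bigcup_(Q in S) Q = P,
      forall Q F, S Q -> is_face Q F -> S F
    & forall Q Q', S Q -> S Q' ->
        is_face Q (Q `&` Q') /\ is_face Q' (Q `&` Q')].

Definition affinely_independent (R : realType) n k (p : 'I_k -> 'rV[R]_n) :
    Prop :=
  forall c : 'I_k -> R,
    \sum_i c i = 0 -> \sum_i c i *: p i = 0 -> forall i, c i = 0.

(* k = 0 gives the empty simplex. *)
Definition is_simplex (R : realType) n (T : set 'rV[R]_n) : Prop :=
  exists k (p : 'I_k -> 'rV[R]_n),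
    affinely_independent p /\ T = convex_hull (range p).

Definition is_triangulation (R : realType) n (P : set 'rV[R]_n)
    (S : set (set 'rV[R]_n)) : Prop :=
  is_subdivision P S /\ forall T, S T -> is_simplex T.

Definition lift_point (R : realType) n (f : 'rV[R]_n -> R) (x : 'rV[R]_n) :
    'rV[R]_(n + 1) :=
  row_mx x (f x)%:M.

(* With the same convention on the empty face as in [is_face]. *)
Definition is_lower_face (R : realType) n (Q F : set 'rV[R]_(n + 1)) : Prop :=
  F = set0 \/
  exists c : 'cV[R]_(n + 1),
    0 < c (rshift n ord0) 0 /\ F = argmin_set c Q.

(* Only the values of f on A matter. *)
Definition induced_subdivision (R : realType) n (A : set 'rV[R]_n)
    (f : 'rV[R]_n -> R) : set (set 'rV[R]_n) :=
  [set (@lsubmx R 1 n 1) @` F |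
     F in is_lower_face (convex_hull (lift_point f @` A))].

Definition is_regular (R : realType) n (P : set 'rV[R]_n)
    (S : set (set 'rV[R]_n)) : Prop :=
  exists (A : set 'rV[R]_n) (f : 'rV[R]_n -> R),
    [/\ finite_set A, A `<=` P, forall v, is_vertex P v -> A v
      & S = induced_subdivision A f].

(* The set of differences of the affine span is its direction space. *)
Definition lin (R : realType) n (T : set 'rV[R]_n) : set 'rV[R]_n :=
  [set u - v | u in affine_hull T & v in affine_hull T].

Definition edge_vector (R : realType) n (T : set 'rV[R]_n) (w : 'rV[R]_n) :
    Prop :=
  exists u v, [/\ is_vertex T u, is_vertex T v & w = u - v].

Definition maximal_independent (R : realType) n (E : set 'rV[R]_n)
    (B : seq 'rV[R]_n) : Prop :=
  [/\ forall b, b \in B -> E b, free B & forall w, E w -> ~~ free (w :: B)].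

(* Independence over R of a sequence of integer vectors is the same as
   independence over the integers. *)
Definition lattice_basis (R : realType) n (L : set 'rV[R]_n)
    (B : seq 'rV[R]_n) : Prop :=
  [/\ forall b, b \in B -> L b, free B
    & forall z, L z -> exists a : 'I_(size B) -> int,
        z = \sum_i (a i)%:~R *: B`_i].

Definition unimodular_simplex (R : realType) n (T : set 'rV[R]_n) : Prop :=
  [/\ is_simplex T,
      forall v, is_vertex T v -> int_vector v
    & exists B : seq 'rV[R]_n,
        maximal_independent (edge_vector T) B /\
        lattice_basis (lin T `&` @int_vector R n) B].

Definition unimodular_triangulation (R : realType) n (P : set 'rV[R]_n)
    (S : set (set 'rV[R]_n)) : Prop :=
  is_triangulation P S /\ forall T, S T -> unimodular_simplex T.

(* Main.v *)
Require Import Defs.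
From HB Require Import structures.
From mathcomp Require Import all_boot all_order all_algebra.
From mathcomp Require Import all_classical all_reals.
From mathcomp Require Import zify ring lra.

(** Let A be the set of lattice points of the integral generalized permutahedron
    P.  Then P is the convex hull of A, and submodularity gives A the symmetric
    exchange property of M-convex sets ([base_exchange]): if x and y are in A
    and [y_i < x_i], then for some j with [x_j < y_j] both x - e_i + e_j and
    y + e_i - e_j are in A.  The rest is about a finite set A of integer points
    with this property.

    The heights on A are built one coordinate at a time.  Two points are in the
    same class at level m when they agree on the coordinates of index at least
    m, so that at level 0 the classes are points and at level n there is only
    one class.  Given a height h and a direction w, keep in every class the
    points that minimize h(x) - w.x.  The invariant [unimodular_above] says
    that the kept points, each marked by its class, form a unimodular
    configuration: real coefficients with an integral sum over each class and
    an integral weighted sum of points are integral.  At level n this says that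
    each cell of the subdivision induced by h is a unimodular simplex; at level
    0 it is trivial.

    From level m to level m + 1, h is replaced by N g + h with N large, where
    on each class at level m + 1 the function g is convex in the coordinate of
    index m, with integral slopes, and no slope occurs in two distinct classes
    nor twice in one.  Convexity and exchange force the points kept in
    a class to lie on at most two consecutive levels of that coordinate
    ([consecutive_levels]).  If there are two levels, exchanging a point of one
    with a point of the other produces an index j such that [w_j] is, up to
    a bounded error, [w_m] minus N times the slope.  For distinct classes these
    values are far apart, so the values of w can be cut at large gaps into
    blocks separating the indices j of one class from the others.  Again by
    exchange, the sum of the coordinates over a block is constant on the kept
    points of a class at level m.  Weighted sums of coordinates over a block
    therefore isolate, up to integers, the total coefficient of the upper level
    of a single class; it is integral, and the invariant at level m applies.

    On the polyhedral side, Farkas' lemma gives separation from the convex hull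
    of finitely many points and linear programming duality.  They show that
    P is the hull of its vertices, and that the hulls of the cells cover P.
    These hulls are closed under faces and meet along common faces, so they
    form the regular subdivision induced by the heights. *)

Set Implicit Arguments.
Unset Strict Implicit.
Unset Printing Implicit Defensive.

Import Order.TTheory GRing.Theory Num.Theory.
Local Open Scope ring_scope.

(** * Heights on a set with the exchange property *)

Lemma sum_indicator (R : pzSemiRingType) (T : finType) (S : {set T}) (k : T) :
  \sum_(a in S) (a == k)%:R = (k \in S)%:R :> R.
Proof.
case kS: (k \in S); last first.
  by apply: big1 => a aS; case: eqP aS => // ->; rewrite kS.
by rewrite (bigD1 k) //= eqxx big1 ?addr0 // => a /andP[_ /negbTE ->].
Qed.

Section Exchange.

Variables (I : finType) (n : nat) (p : I -> 'I_n -> int).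

(** [x' = x + e_i - e_j]; the points are known only through their coordinates. *)
Definition shifted (x : I) (i j : 'I_n) (x' : I) : Prop :=
  forall a, p x' a = p x a + (a == i)%:R - (a == j)%:R.

(** Symmetric exchange: the finite family of integer points [p] is an M-convex
    set. *)
Definition exchange_property : Prop :=
  forall x y i, p y i < p x i ->
    exists j x' y', [/\ p x j < p y j, shifted x j i x' & shifted y i j y'].

(** The sum of the coordinates of a point over a set of indices. *)
Definition part (S : {set 'I_n}) (x : I) : int := \sum_(a in S) p x a.

(** The l1 distance between two points. *)
Definition ldist (x y : I) : nat := (\sum_a `|p x a - p y a|)%N.

Lemma part_shifted S x i j x' : shifted x i j x' ->
  part S x' = part S x + (i \in S)%:R - (j \in S)%:R.
Proof.
move=> sx; rewrite /part (eq_bigr _ (fun a _ => sx a)).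
by rewrite sumrB big_split /= !sum_indicator.
Qed.

(** If x does not maximize the coordinate sum over [S], an elementary move into
    [S] increases it, and this move goes towards the better point y: exchange
    y with x until an index outside [S] is used. *)
Lemma improving_shift x y (S : {set 'I_n}) :
  exchange_property -> part S x < part S y ->
  exists i j x', [/\ i \in S, j \notin S, p x i < p y i, p y j < p x j
                   & shifted x i j x'].
Proof.
move=> ex; have [d] := ubnP (ldist x y); elim: d y => // d IH y dle xy.
have [i /andP[iS xyi]|none] :=
  pickP (fun i => (i \in S) && (p x i < p y i)); last first.
  suff: part S y <= part S x by rewrite leNgt xy.
  by apply: ler_sum => a aS; rewrite leNgt; move: (none a); rewrite /= aS /= => ->.
have [j [y' [x' [yxj sy sx]]]] := ex y x i xyi.
have [jS|jS] := boolP (j \in S); last by exists i, j, x'.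
have ij : i != j by apply/eqP => e; move: xyi yxj; rewrite e => h1 h2; lia.
have y'E : part S y' = part S y by rewrite (part_shifted _ sy) iS jS addrK.
have ltd : (ldist x y' < ldist x y)%N.
  rewrite /ldist [X in (X < _)%N](bigD1 i) //= [X in (_ < X)%N](bigD1 i) //= -addSn.
  apply: leq_add.
    by rewrite sy eqxx (negbTE ij) /=; lia.
  apply: leq_sum => a ai; rewrite sy (negbTE ai) /=.
  by case: eqP => [->|_]; lia.
have [||i' [j' [x'' [i'S j'S lti ltj sx'']]]] := IH y'; [lia|by rewrite y'E|].
exists i', j', x''; split=> //.
  move: lti; rewrite sy; case: eqP => [->|_]; case: eqP => [->|_] /=; lia.
move: ltj; rewrite sy; case: eqP => [->|_]; case: eqP => [->|_] /=; lia.
Qed.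

(** The points x and y agree on the coordinates of index at least [m]. *)
Definition same_above (m : nat) (x y : I) : bool :=
  [forall a : 'I_n, (m <= a)%N ==> (p x a == p y a)].

Lemma same_aboveP m x y :
  reflect (forall a : 'I_n, (m <= a)%N -> p x a = p y a) (same_above m x y).
Proof.
apply: (iffP forallP) => [h a ma|h a]; first by apply/eqP; apply: (implyP (h a)).
by apply/implyP => ma; apply/eqP; exact: h.
Qed.

Lemma same_above_refl m : reflexive (same_above m).
Proof. by move=> x; apply/same_aboveP. Qed.

Lemma same_above_sym m : symmetric (same_above m).
Proof. by move=> x y; apply/same_aboveP/same_aboveP => h a ma; rewrite h. Qed.

Lemma same_above_trans m : transitive (same_above m).
Proof.
move=> y x z /same_aboveP h1 /same_aboveP h2; apply/same_aboveP => a ma.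
by rewrite h1 ?h2.
Qed.

Lemma same_aboveS m (mn : (m < n)%N) x y :
  same_above m x y = same_above m.+1 x y && (p x (Ordinal mn) == p y (Ordinal mn)).
Proof.
apply/same_aboveP/andP => [h|[/same_aboveP h /eqP e] a].
  by split; [apply/same_aboveP => a ma; apply/h/ltnW|rewrite h].
rewrite leq_eqVlt => /predU1P[ma|]; last exact: h.
by rewrite (_ : a = Ordinal mn) //; apply: val_inj.
Qed.

Lemma shifted_same_above m x y i j x' : same_above m x y ->
  p x i != p y i -> p x j != p y j -> shifted x i j x' -> same_above m x' y.
Proof.
move=> /same_aboveP xy xi xj sx; apply/same_aboveP => a ma; rewrite sx xy //.
case: eqP => [ai|_]; first by rewrite -ai xy ?eqxx in xi.
by case: eqP => [aj|_]; [rewrite -aj xy ?eqxx in xj|rewrite addr0 subr0].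
Qed.

(** The class of x at level [m], as a set of indices of points. *)
Definition above_class m (x : I) : {set I} := [set y | same_above m x y].

Lemma above_classP m x y : (above_class m x == above_class m y) = same_above m x y.
Proof.
apply/eqP/idP => [/setP/(_ y)|xy]; first by rewrite !inE same_above_refl => ->.
apply/setP => z; rewrite !inE; apply/idP/idP; apply: same_above_trans => //.
by rewrite same_above_sym.
Qed.

Section Heights.

Variable (R : archiRealFieldType).
Implicit Types (h : I -> R) (w : 'I_n -> R) (c : I -> R).

(** The pairing of a direction with a point. *)
Definition dot w (x : I) : R := \sum_a w a * (p x a)%:~R.

Lemma dot_shifted w x i j x' : shifted x i j x' -> dot w x' = dot w x + w i - w j.
Proof.
have ind k : \sum_a w a * (a == k)%:R = w k.
  rewrite (bigD1 k) //= eqxx mulr1 big1 ?addr0 // => a /negbTE ->.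
  by rewrite mulr0.
move=> sx; rewrite /dot -(ind i) -(ind j) -big_split -sumrB /=.
apply: eq_bigr => a _; rewrite sx !rmorphD rmorphN /= !mulrz_nat; ring.
Qed.

(** The point x minimizes h - w in its class at level [m]. *)
Definition minimal_above m h w (x : I) : bool :=
  [forall y, same_above m x y ==> (h x - dot w x <= h y - dot w y)].

Lemma minimal_aboveP m h w x :
  reflect (forall y, same_above m x y -> h x - dot w x <= h y - dot w y)
          (minimal_above m h w x).
Proof. by apply: (iffP forallP) => H y; [apply/implyP|apply/implyP/H]. Qed.

(** The points of [V], each completed with the basis vector of its class at
    level [m], are linearly independent and span a saturated lattice: all real
    coefficients that yield an integer vector are integers.  The independence
    follows since a linear relation can be scaled. *)
Definition unimodular_above m (V : pred I) : Prop :=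
  forall c, (forall x, ~~ V x -> c x = 0) ->
    (forall x, \sum_(y | same_above m x y) c y \is a Num.int) ->
    (forall a, \sum_y c y * (p y a)%:~R \is a Num.int) ->
  forall x, c x \is a Num.int.

(** Weighted sums of an integral function that depends only on the class. *)
Lemma int_sum_class m c (phi : {set I} -> int) :
  (forall x, \sum_(y | same_above m x y) c y \is a Num.int) ->
  \sum_y c y * (phi (above_class m y))%:~R \is a Num.int.
Proof.
move=> cint; rewrite (partition_big (above_class m) predT) //=.
apply: rpred_sum => C _.
rewrite (eq_bigr (fun y => c y * (phi C)%:~R)) => [|y /eqP -> //].
rewrite -mulr_suml rpredM ?intr_int //.
have [x /eqP <-|none] := pickP (fun x => above_class m x == C).
  by rewrite (eq_bigl (same_above m x)) // => y; rewrite above_classP same_above_sym.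
by rewrite big_pred0 ?rpred0.
Qed.

(** No coordinate of [w] lies in the interval ]theta, theta + K]. *)
Definition no_value_in w (theta K : R) := forall a, w a <= theta \/ theta + K < w a.

(** The n + 1 consecutive intervals of length [K] starting at [W] cannot all
    contain one of the n coordinates of [w]. *)
Lemma value_gap w (W K : R) : 0 < K ->
  exists theta, [/\ W <= theta, theta <= W + n%:R * K & no_value_in w theta K].
Proof.
move=> K0.
have [/existsP[t /forallP ht]|/existsPn no] := boolP
  [exists t : 'I_n.+1, forall a, (w a <= W + t%:R * K) || (W + t%:R * K + K < w a)].
  exists (W + t%:R * K); split.
  - by rewrite lerDl mulr_ge0 // ltW.
  - by rewrite lerD2l ler_pM2r // ler_nat -ltnS.
  - by move=> a; apply/orP.
have {}no (t : 'I_n.+1) : exists a, (W + t%:R * K < w a) && (w a <= W + t%:R * K + K).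
  have /forallPn[a] := no t; rewrite negb_or -ltNge -leNgt => ?; by exists a.
have [s sP] := fin_all_exists no.
have: (#|'I_n.+1| <= #|'I_n|)%N.
  apply: (@leq_card _ _ s) => t1 t2 e; apply: val_inj => /=.
  have gap (u v : 'I_n.+1) : s u = s v -> (u <= v)%N.
    move=> uv; rewrite -ltnS -(ltr_nat R) -natr1 -(ltr_pM2r K0).
    by have /andP[+ _] := sP u; have /andP[_] := sP v; rewrite uv; lra.
  by apply/eqP; rewrite eqn_leq !gap.
by rewrite !card_ord ltnn.
Qed.


(** Two points of the same class cannot both be minimal if their levels are at
    least two apart: with s1 and s2 the slopes crossed by an exchange, the gain
    N (s1 - s2) exceeds the variation of the bounded part. *)
Let level_gap_arith (N H s1 s2 q1 q2 a1 a2 a3 a4 d1 d2 e1 e2 : R) :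
  4 * H < N -> 1 <= s1 - s2 ->
  a1 <= H -> a2 <= H -> - H <= a1 -> - H <= a2 ->
  a3 <= H -> a4 <= H -> - H <= a3 -> - H <= a4 ->
  N * q2 + a2 - d2 <= N * (q2 + s2) + a4 - (d2 + e1 - e2) ->
  N * (q1 + s1) + a1 - d1 <= N * q1 + a3 - (d1 + e2 - e1) -> False.
Proof.
move=> NH ss h1 h2 h3 h4 h5 h6 h7 h8 l1 l2.
have N0 : 0 <= N by lra.
have : N * 1 <= N * (s1 - s2) by rewrite ler_wpM2l.
lra.
Qed.

Section Refine.

Variables (m : nat) (mn : (m < n)%N) (h : I -> R).
Hypothesis ex : exchange_property.

(** The step from level [m] to level [m.+1]: [lvl] is the coordinate that is
    released, [idx] numbers the classes at level [m.+1], and [slope] is the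
    increment of [quad] from one level to the next ([quad_succ]).  As [idx] is
    smaller than [M], the slope determines the class. *)
Let ell := Ordinal mn.
Let lvl (x : I) : int := p x ell.
Let M : nat := #|{set I}|.
Let idx (x : I) : nat := enum_rank (above_class m.+1 x).
Let slope (x : I) : int := M%:Z * lvl x + idx x.
Let quad (x : I) : R :=
  M%:R * ((lvl x)%:~R * ((lvl x)%:~R - 1) / 2) + (idx x)%:R * (lvl x)%:~R.
Let H : R := \sum_x `|h x|.
Let K : R := 6 * H + 1.
Let N : R := n.+1%:R * K + 4 * H + 1.

(** [N] exceeds every error bound met below: 4 [H] for an exchange, and [n.+1]
    gaps of length [K]. *)
Definition refined_height (x : I) : R := N * quad x + h x.
Let h' := refined_height.

Let H0 : 0 <= H. Proof. exact: sumr_ge0. Qed.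
Let K0 : 0 < K. Proof. by rewrite /K; have := H0; lra. Qed.
Let hle x : h x <= H.
Proof.
by rewrite (le_trans (ler_norm _)) // /H (bigD1 x) //= lerDl sumr_ge0.
Qed.
Let hge x : - H <= h x.
Proof.
by rewrite lerNl (le_trans (ler_norm _)) // normrN /H (bigD1 x) //= lerDl sumr_ge0.
Qed.
Let N_gt : n.+1%:R * K + 4 * H < N. Proof. by rewrite /N ltrDl. Qed.
Let N_gt4 : 4 * H < N.
Proof. by rewrite (le_lt_trans _ N_gt) // lerDr mulr_ge0 // ltW. Qed.
Let M_gt0 : (0 < M)%N. Proof. by apply/card_gt0P; exists finset.set0. Qed.

Let idx_same x y : same_above m.+1 x y -> idx x = idx y.
Proof. by rewrite -above_classP /idx => /eqP ->. Qed.

Let idx_lt x : (idx x < M)%N. Proof. exact: ltn_ord. Qed.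

Let quad_same x y : same_above m.+1 x y -> lvl x = lvl y -> quad x = quad y.
Proof. by move=> xy e; rewrite /quad (idx_same xy) e. Qed.

Let quad_succ x y : same_above m.+1 x y -> lvl x = lvl y + 1 ->
  quad x = quad y + (slope y)%:~R.
Proof.
move=> xy e; rewrite /quad /slope (idx_same xy) e !rmorphD rmorphM /= -!pmulrn.
by field.
Qed.

Let slope_inj x y : slope x = slope y -> same_above m.+1 x y.
Proof.
move=> e; have : idx x = idx y.
  have := congr1 (modz^~ M%:Z) e; rewrite /slope /= !(mulrC M%:Z) !modzMDl !modz_nat.
  by move=> [] /eqP; rewrite !modn_small ?idx_lt // => /eqP.
by move=> /val_inj/enum_rank_inj/eqP; rewrite above_classP.
Qed.

Let slope_lt x y : same_above m.+1 x y -> lvl x < lvl y -> slope x < slope y.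
Proof. by move=> xy lt; rewrite /slope (idx_same xy) ltrD2r ltr_pM2l. Qed.

Section Direction.

Variable w : 'I_n -> R.

Let V' := minimal_above m.+1 h' w.
(** Minimal up to the error 4 [H] in its class at level [m]; this error is what
    an exchange between two minimal points may cost. *)
Let near x := forall z, same_above m x z -> h x - dot w x <= h z - dot w z + 4 * H.
(** The upper level set of [w]. *)
Let U (theta : R) : {set 'I_n} := [set a | theta < w a].

Let minimal_below x : V' x -> minimal_above m h w x.
Proof.
move=> /minimal_aboveP Vx; apply/minimal_aboveP => y.
rewrite (same_aboveS mn) => /andP[xy /eqP e].
by have := Vx y xy; rewrite /h' /refined_height (quad_same xy e); lra.
Qed.

Let minimal_near x : V' x -> near x.
Proof.
move=> /minimal_below /minimal_aboveP Vx y xy.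
by have := Vx y xy; have := H0; lra.
Qed.

(** An improving move into [U theta] would gain more than [K] in the direction
    [w], hence contradict near minimality. *)
Let near_part_le x y theta : same_above m x y -> near x ->
  no_value_in w theta K -> part (U theta) y <= part (U theta) x.
Proof.
move=> xy nx gap; rewrite leNgt; apply/negP.
move=> /(improving_shift ex)[i [j [x' [iU jU xi xj sx]]]].
have xx' : same_above m x x'.
  rewrite same_above_sym (same_above_trans _ (_ : same_above m y x)) //.
    by apply: (shifted_same_above xy _ _ sx); rewrite ?(lt_eqF xi) ?(gt_eqF xj).
  by rewrite same_above_sym.
have := nx x' xx'; rewrite (dot_shifted w sx).
move: iU jU; rewrite !inE -leNgt => iU jU.
have [|wi] := gap i; first by rewrite leNgt iU.
have := hle x'; have := hge x; rewrite /K in wi; lra.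
Qed.

Let near_part x y theta : same_above m x y -> near x -> near y ->
  no_value_in w theta K -> part (U theta) x = part (U theta) y.
Proof.
move=> xy nx ny gap; apply/eqP; rewrite eq_le !near_part_le //.
by rewrite same_above_sym.
Qed.

(** Exchanging in the coordinate [ell] moves x and y to each other's level; the
    index j used is tied to the slope, up to 2 [H], by the minimality of x and
    of y. *)
Let consecutive_levels x y : V' x -> V' y -> same_above m.+1 x y -> lvl y < lvl x ->
  lvl x = lvl y + 1 /\
  exists2 j, `|w ell - w j - N * (slope y)%:~R| <= 2 * H &
    forall theta, no_value_in w theta K ->
      part (U theta) x =
      part (U theta) y + (ell \in U theta)%:R - (j \in U theta)%:R.
Proof.
move=> Vx Vy xy lt; have [j [x' [y' [ltj sx sy]]]] := ex lt.
have jl : (j == ell) = false by apply/eqP => e; move: lt ltj; rewrite e /lvl; lia.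
have lj : (ell == j) = false by rewrite eq_sym.
have yx : same_above m.+1 y x by rewrite same_above_sym.
have x'y : same_above m.+1 x' y.
  by apply: (shifted_same_above xy _ _ sx); rewrite ?(lt_eqF ltj) ?(gt_eqF lt).
have y'x : same_above m.+1 y' x.
  by apply: (shifted_same_above yx _ _ sy); rewrite ?(gt_eqF ltj) ?(lt_eqF lt).
have x'x : same_above m.+1 x' x by apply: same_above_trans x'y yx.
have y'y : same_above m.+1 y' y by apply: same_above_trans y'x xy.
have lx' : lvl x' = lvl x - 1 by rewrite /lvl sx eqxx lj addr0.
have ly' : lvl y' = lvl y + 1 by rewrite /lvl sy eqxx lj subr0.
have /minimal_aboveP mx := Vx; have /minimal_aboveP my := Vy.
have := mx x'; have := my y'; have := mx y'; have := my x'.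
rewrite (same_above_sym _ y) x'y (same_above_sym _ x) y'x.
rewrite (same_above_sym _ y) y'y (same_above_sym _ x) x'x.
move=> /(_ isT) yx'le /(_ isT) xy'le /(_ isT) yy'le /(_ isT) xx'le.
move: yx'le xy'le yy'le xx'le.
rewrite (dot_shifted w sx) (dot_shifted w sy) /h' /refined_height.
have qx : quad x = quad x' + (slope x')%:~R.
  by apply: quad_succ; [rewrite same_above_sym|rewrite lx' subrK].
have qy : quad y' = quad y + (slope y)%:~R by exact: quad_succ.
have hx := hle x; have hx1 := hge x; have hy := hle y; have hy1 := hge y.
have hx' := hle x'; have hx1' := hge x'; have hy' := hle y'; have hy1' := hge y'.
have [l2|l2] := ltP (lvl y + 1) (lvl x).
  have : 1 <= (slope x')%:~R - (slope y)%:~R :> R.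
    rewrite -rmorphB /= ler1z lerBrDr lez1D slope_lt //.
      by rewrite same_above_sym.
    by rewrite lx' ltrBrDr.
  rewrite qx qy => sl _ _ l4 l5; exfalso.
  by apply: (level_gap_arith N_gt4 sl hx hy hx1 hy1 hx' hy' hx1' hy1' l4 l5).
have lE : lvl x = lvl y + 1 by apply/eqP; rewrite eq_le l2 lezD1.
have q' : quad x' = quad y by apply: quad_same => //; rewrite lx' lE addrK.
have sl : slope x' = slope y by rewrite /slope (idx_same x'y) lx' lE addrK.
rewrite qx qy q' sl !mulrDr => l1 l3 l4 l5; split=> //; exists j.
  by rewrite ler_norml; apply/andP; split; lra.
move=> theta gap.
have x'ym : same_above m x' y.
  by rewrite (same_aboveS mn) x'y /=; apply/eqP; rewrite -/(lvl x') lx' lE addrK.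
(* As y' is no better than x, the loss from y to x' is at most 4 H. *)
have nx' : near x'.
  move=> z x'z; have := minimal_below Vy => /minimal_aboveP /(_ z).
  rewrite (same_above_trans _ x'z) ?(same_above_sym _ y) // => /(_ isT).
  by rewrite (dot_shifted w sx); lra.
rewrite -(near_part x'ym nx' (minimal_near Vy) gap) (part_shifted _ sx); ring.
Qed.

(** [up y]: the minimal point y is on the upper level of its class.  [low C] is
    some minimal point of [C] on the lower level. *)
Let up y := V' y && [exists z, [&& V' z, same_above m.+1 y z & lvl z < lvl y]].
Let low (C : {set I}) := [pick z | [&& V' z, z \in C & ~~ up z]].

Let low_level y z : V' y -> V' z -> same_above m.+1 y z -> ~~ up z ->
  lvl y = lvl z + (up y)%:R.
Proof.
move=> Vy Vz yz; rewrite /up Vz Vy /= => /existsPn nz.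
have [/existsP[t /and3P[Vt yt lt]]|/existsPn ny] := boolP
    [exists t, [&& V' t, same_above m.+1 y t & lvl t < lvl y]].
  have ltzy : lvl z < lvl y.
    rewrite ltNge; apply/negP => lyz; have := nz t.
    rewrite Vt (lt_le_trans lt lyz) (same_above_trans _ yt) //.
    by rewrite same_above_sym.
  by have [-> _] := consecutive_levels Vy Vz yz ltzy.
have := ny z; have := nz y; rewrite Vy Vz yz same_above_sym yz /= -!leNgt => l1 l2.
by rewrite addr0; apply/eqP; rewrite eq_le l1 l2.
Qed.

Let lowP y : V' y -> exists z, [/\ low (above_class m.+1 y) = Some z, V' z,
  same_above m.+1 y z & ~~ up z].
Proof.
move=> Vy; rewrite /low; case: pickP => [z /and3P[Vz + nz]|none].
  by rewrite inE => yz; exists z.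
exfalso; have := none y; rewrite /= Vy inE same_above_refl /= => /negbFE uy.
have /andP[_ /existsP[z /and3P[Vz yz lt]]] := uy.
have := none z; rewrite /= Vz inE yz /= => /negbFE.
move=> /andP[_ /existsP[t /and3P[Vt zt lt']]].
have yt := same_above_trans yz zt.
have [e1 _] := consecutive_levels Vy Vz yz lt.
have [e2 _] := consecutive_levels Vy Vt yt (lt_trans lt' lt).
by have /addIr e := etrans (esym e2) e1; move: lt'; rewrite e ltxx.
Qed.

Variable c : I -> R.
Hypothesis c_supp : forall x, ~~ V' x -> c x = 0.
Hypothesis c_class : forall x, \sum_(y | same_above m.+1 x y) c y \is a Num.int.
Hypothesis c_coord : forall a, \sum_y c y * (p y a)%:~R \is a Num.int.

Let int_sum_part S : \sum_y c y * (part S y)%:~R \is a Num.int.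
Proof.
under eq_bigr do rewrite /part rmorph_sum mulr_sumr.
by rewrite exchange_big /= rpred_sum.
Qed.

Let int_sum_up_all : \sum_y c y * (up y)%:R \is a Num.int.
Proof.
have -> : \sum_y c y * (up y)%:R = \sum_y c y * (p y ell)%:~R
  - \sum_y c y * (if low (above_class m.+1 y) is Some z then lvl z else 0)%:~R.
  rewrite -sumrB; apply: eq_bigr => y _.
  have [Vy|/c_supp ->] := boolP (V' y); last by rewrite !mul0r subr0.
  have [z [-> Vz yz nz]] := lowP Vy.
  rewrite -/(lvl y) (low_level Vy Vz yz nz) rmorphD /= mulrz_nat; ring.
by rewrite rpredB // (int_sum_class (fun C => if low C is Some z then lvl z else 0)).
Qed.

(** The total coefficient of the upper level of a class is integral: the block
    of indices j with [t1 < w j <= t2] contains the exchange index of every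
    upper point in the class of x, and of no upper point in another class. *)
Let int_sum_up x : V' x -> \sum_(y | up y && same_above m.+1 x y) c y \is a Num.int.
Proof.
move=> Vx; have [z0 [Ez0 Vz0 xz0 nz0]] := lowP Vx.
pose W := w ell - N * (slope z0)%:~R.
(* Exchange indices j of the class of x satisfy |w j - W| <= 2 H; for the other
   classes |w j - W| is at least N - 2 H, as slopes are integers. *)
have [t1 [t1ge t1le gap1]] := value_gap w (W - 2 * H - n.+1%:R * K) K0.
have [t2 [t2ge t2le gap2]] := value_gap w (W + 2 * H) K0.
rewrite -natr1 in t1ge t1le.
pose B (y : I) : int := part (U t1) y - part (U t2) y.
pose b (a : 'I_n) : int := (a \in U t1)%:R - (a \in U t2)%:R.
pose q (C : {set I}) : int := if low C is Some z then B z else 0.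
have BE y : V' y -> B y = q (above_class m.+1 y) + b ell * (up y)%:R
    - (up y && same_above m.+1 x y)%:R.
  move=> Vy; have [z [Ez Vz yz nz]] := lowP Vy.
  rewrite /q Ez; have := low_level Vy Vz yz nz; case uy: (up y) => /= lE.
    have [|_ [j jle jE]] := consecutive_levels Vy Vz yz _; first by rewrite lE ltrDl.
    rewrite /B !jE // (_ : (same_above m.+1 x y)%:R = b j); first by rewrite /b; ring.
    move: jle; rewrite ler_norml => /andP[jle1 jle2].
    rewrite /b !inE; have [xy|xy] := boolP (same_above m.+1 x y).
      have zz0 : z = z0.
        have : above_class m.+1 x == above_class m.+1 y by rewrite above_classP.
        by move=> /eqP e; move: Ez0; rewrite e Ez => -[].
      rewrite zz0 -/W in jle1 jle2.
      have -> : t1 < w j by rewrite /W in t1le; have := K0; lra.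
      suff -> : t2 < w j = false by [].
      by apply: le_gtF; rewrite /W in t2ge; lra.
    have szz0 : slope z != slope z0.
      apply: contra xy => /eqP/slope_inj zz0.
      apply: (same_above_trans xz0); rewrite same_above_sym.
      exact: (same_above_trans yz).
    suff -> : (t1 < w j) = (t2 < w j) by rewrite subrr.
    have [lt2|] := ltP t2 (w j).
      by apply: lt_trans lt2; have := K0; have := H0; lra.
    move=> le2; apply: le_gtF; rewrite leNgt; apply/negP => lt1.
    have N1 := N_gt; rewrite -natr1 in N1.
    have N0 : 0 < N by apply: le_lt_trans N_gt4; rewrite mulr_ge0.
    have [ltz|gtz|ez] := ltgtP (slope z) (slope z0); last by rewrite ez eqxx in szz0.
      have : N * 1 <= N * ((slope z0)%:~R - (slope z)%:~R).
        by rewrite ler_pM2l // -rmorphB /= ler1z lerBrDr lez1D.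
      rewrite mulr1 mulrBr; rewrite /W in t2le; have := K0; lra.
    have : N * 1 <= N * ((slope z)%:~R - (slope z0)%:~R).
      by rewrite ler_pM2l // -rmorphB /= ler1z lerBrDr lez1D.
    rewrite mulr1 mulrBr; rewrite /W in t1ge; have := K0; lra.
  have yzm : same_above m y z.
    by rewrite (same_aboveS mn) yz /=; apply/eqP; rewrite -/(lvl y) lE addr0.
  have E := near_part yzm (minimal_near Vy) (minimal_near Vz).
  by rewrite /B !E // mulr0 addr0 subr0.
have -> : \sum_(y | up y && same_above m.+1 x y) c y =
    \sum_y c y * (q (above_class m.+1 y))%:~R
    + (b ell)%:~R * \sum_y c y * (up y)%:R
    - (\sum_y c y * (part (U t1) y)%:~R - \sum_y c y * (part (U t2) y)%:~R).
  rewrite big_mkcond mulr_sumr -big_split /= -!sumrB /=; apply: eq_bigr => y _.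
  have [Vy|/c_supp ->] := boolP (V' y); last by rewrite !mul0r !mulr0 if_same; ring.
  rewrite -mulrBr -rmorphB /= -/(B y) (BE y Vy).
  move: (q _) (b ell) => q0 b0; rewrite rmorphB rmorphD rmorphM /= !mulrz_nat.
  by case: ifP => _ /=; ring.
apply: rpredB; last exact: rpredB.
apply: rpredD; first exact: int_sum_class.
by apply: rpredM; first exact: intr_int.
Qed.

(** So is the total coefficient of each class at level [m]: such a class is the
    upper or the lower level of its class at level [m.+1]. *)
Let int_sum_same x : \sum_(y | same_above m x y) c y \is a Num.int.
Proof.
have [/existsP[z /andP[Vz xz]]|/existsPn none] := boolP
    [exists z, V' z && same_above m x z]; last first.
  rewrite big1 // => y xy; apply: c_supp.
  by have := none y; rewrite xy andbT.
rewrite (eq_bigl (same_above m z)); last first.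
  move=> y; apply/idP/idP; apply: same_above_trans => //.
  by rewrite same_above_sym.
have supp (P Q : pred I) : (forall y, V' y -> P y = Q y) ->
    \sum_(y | P y) c y = \sum_(y | Q y) c y.
  move=> PQ; rewrite big_mkcond [RHS]big_mkcond; apply: eq_bigr => y _.
  by have [/PQ ->|/c_supp ->] := boolP (V' y); rewrite ?if_same.
have [z0 [_ Vz0 zz0 nz0]] := lowP Vz.
have lz := low_level Vz Vz0 zz0 nz0.
have ly y : V' y -> same_above m.+1 z y -> lvl y = lvl z0 + (up y)%:R.
  move=> Vy zy; apply: low_level => //; apply: same_above_trans zz0.
  by rewrite same_above_sym.
case uz: (up z) in lz.
  rewrite (supp _ (fun y => up y && same_above m.+1 z y)) ?int_sum_up // => y Vy.
  rewrite (same_aboveS mn) andbC; case zy: (same_above m.+1 z y); rewrite ?andbF //.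
  rewrite !andbT -/(lvl z) -/(lvl y) lz (ly y Vy zy).
  by rewrite (inj_eq (addrI _)); case: (up y).
have E : \sum_(y | same_above m.+1 z y) c y =
    \sum_(y | up y && same_above m.+1 z y) c y + \sum_(y | same_above m z y) c y.
  rewrite (bigID up) /=; congr (_ + _); first by apply: eq_bigl => y; rewrite andbC.
  apply: supp => y Vy.
  rewrite (same_aboveS mn); case zy: (same_above m.+1 z y) => //=.
  rewrite -/(lvl z) -/(lvl y) lz (ly y Vy zy).
  by rewrite (inj_eq (addrI _)); case: (up y).
by rewrite -(addKr (\sum_(y | up y && same_above m.+1 z y) c y) (bigop _ _ _)) -E
  addrC rpredB ?int_sum_up.
Qed.

Lemma refined_integral :
  unimodular_above m (minimal_above m h w) -> forall x, c x \is a Num.int.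
Proof.
move=> uni; apply: uni => // x nx; apply: c_supp.
by apply: contra nx; exact: minimal_below.
Qed.

End Direction.
End Refine.

(** At level [n] all points form a single class, so the invariant says that the
    minimal points of each tilted height span a unimodular simplex. *)
Theorem unimodular_height : exchange_property ->
  (forall x y, p x =1 p y -> x = y) ->
  exists h, forall w c,
    (forall x y, h y - dot w y < h x - dot w x -> c x = 0) ->
    \sum_x c x \is a Num.int ->
    (forall a, \sum_x c x * (p x a)%:~R \is a Num.int) ->
  forall x, c x \is a Num.int.
Proof.
move=> ex inj.
suff: forall m, (m <= n)%N ->
    exists h, forall w, unimodular_above m (minimal_above m h w).
  move=> /(_ n (leqnn n)) [h hP]; exists h => w c supp csum cint.
  have all_same x y : same_above n x y.
    by apply/same_aboveP => a; rewrite leqNgt ltn_ord.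
  apply: hP cint => [x|x].
    move=> /forallPn[y]; rewrite all_same /= -ltNge; exact: supp.
  by rewrite (eq_bigl predT) // => y; rewrite all_same.
elim=> [_|m IH mn].
  exists (fun=> 0) => w c _ csum _ x; have := csum x.
  rewrite (big_pred1 x) // => y /=; apply/idP/eqP => [/same_aboveP xy|->].
    by apply: inj => a; rewrite xy.
  exact: same_above_refl.
have [h hP] := IH (ltnW mn); exists (refined_height mn h) => w c supp csum cint x.
exact: (refined_integral ex supp csum cint (hP w)).
Qed.

End Heights.
End Exchange.

(** * Linear functionals and Farkas' lemma *)

Local Notation "x |* u" := ((x *m u) 0 0) (at level 40, left associativity).

Section Functional.
Variables (R : comPzRingType) (m : nat).
Implicit Types (x y : 'rV[R]_m) (u v : 'cV[R]_m) (a : R).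

Lemma evBl x y u : (x - y) |* u = x |* u - y |* u.
Proof. by rewrite mulmxBl mxE [X in _ + X]mxE. Qed.
Lemma evZl a x u : (a *: x) |* u = a * (x |* u).
Proof. by rewrite -scalemxAl mxE. Qed.
Lemma evBr x u v : x |* (u - v) = x |* u - x |* v.
Proof. by rewrite mulmxBr mxE [X in _ + X]mxE. Qed.
Lemma evNr x u : x |* (- u) = - (x |* u).
Proof. by rewrite mulmxN mxE. Qed.
Lemma evZr a x u : x |* (a *: u) = a * (x |* u).
Proof. by rewrite -scalemxAr mxE. Qed.
Lemma ev_suml (I : finType) (P : pred I) (F : I -> 'rV[R]_m) u :
  (\sum_(i | P i) F i) |* u = \sum_(i | P i) F i |* u.
Proof. by rewrite mulmx_suml summxE. Qed.

Lemma sum_row_mx (J : finType) k (A : J -> 'rV[R]_m) (B : J -> 'rV[R]_k) :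
  \sum_j row_mx (A j) (B j) = row_mx (\sum_j A j) (\sum_j B j).
Proof. by elim/big_rec3: _ => [|j X Y Z _ ->]; rewrite ?row_mx0 // add_row_mx. Qed.

End Functional.

Section Farkas.
Variables (R : realFieldType) (m : nat).

(** Farkas' lemma by induction on the number of generators (Bartl's proof). *)
Lemma farkas_ord k (a : 'I_k -> 'rV[R]_m) (b : 'rV[R]_m) :
  (exists2 y : 'I_k -> R, forall i, 0 <= y i & b = \sum_i y i *: a i) \/
  (exists2 u : 'cV[R]_m, forall i, a i |* u <= 0 & 0 < b |* u).
Proof.
elim: k a b => [|k IH] a b.
  have [->|/rV0Pn[j bj]] := eqVneq b 0.
    by left; exists (fun=> 0); [case|rewrite big_ord0].
  right; exists (b 0 j *: delta_mx j 0) => [[]//|].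
  by rewrite evZr -colE mxE lt_neqAle eq_sym mulf_neq0 //= -expr2 sqr_ge0.
have ext (y : 'I_k -> R) (z : R) (v : 'rV[R]_m) : (forall i, 0 <= y i) -> 0 <= z ->
    v = z *: a ord0 + \sum_i y i *: a (lift ord0 i) ->
    exists2 y : 'I_k.+1 -> R, forall i, 0 <= y i & v = \sum_i y i *: a i.
  move=> y0 z0 ->; exists (fun i => oapp y z (unlift ord0 i)).
    by move=> i; case: unliftP => [j _|_] /=.
  rewrite big_ord_recl unlift_none /=; congr (_ + _).
  by apply: eq_bigr => i _; rewrite liftK.
have [[y y0 bE]|[u0 au bu]] := IH (fun i => a (lift ord0 i)) b.
  by left; apply: (ext y 0) => //; rewrite scale0r add0r.
have all_ord (u : 'cV[R]_m) : a ord0 |* u <= 0 ->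
    (forall i, a (lift ord0 i) |* u <= 0) -> forall i, a i |* u <= 0.
  by move=> h0 h1 i; case: (unliftP ord0 i) => [j ->|->].
set s := a ord0 |* u0.
have [s0|s0] := lerP s 0; first by right; exists u0; first exact: all_ord.
(* As functionals, the vectors are composed with the projection along u0 onto the
   kernel of the first one. *)
pose proj (v : 'rV[R]_m) := v - (v |* u0 / s) *: a ord0.
have projE v u : proj v |* u = v |* (u - (a ord0 |* u / s) *: u0).
  by rewrite /proj evBl evZl evBr evZr -/s; field; rewrite gt_eqF.
have [[y y0 bE]|[u au' bu']] := IH (fun i => proj (a (lift ord0 i))) (proj b).
  left; apply: (ext y (b |* u0 / s - \sum_i y i * (a (lift ord0 i) |* u0 / s))) => //.
    have sum_le0 : \sum_i y i * (a (lift ord0 i) |* u0 / s) <= 0.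
      rewrite -oppr_ge0 -sumrN; apply: sumr_ge0 => i _.
      rewrite oppr_ge0 mulr_ge0_le0 // pmulr_lle0 ?invr_gt0 //.
    by rewrite subr_ge0 (le_trans sum_le0) // divr_ge0 ?ltW.
  move: bE; rewrite /proj => /eqP; rewrite subr_eq => /eqP bE; rewrite [LHS]bE.
  under eq_bigr do rewrite scalerBr scalerA.
  rewrite sumrB -scaler_suml scalerBl [RHS]addrC addrA.
  by rewrite addrAC.
right; exists (u - (a ord0 |* u / s) *: u0); last by rewrite -projE.
apply: all_ord => [|i]; last by rewrite -projE.
by rewrite evBr evZr -/s divfK ?subrr // gt_eqF.
Qed.

Lemma farkas (J : finType) (a : J -> 'rV[R]_m) (b : 'rV[R]_m) :
  (exists2 y : J -> R, forall i, 0 <= y i & b = \sum_i y i *: a i) \/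
  (exists2 u : 'cV[R]_m, forall i, a i |* u <= 0 & 0 < b |* u).
Proof.
have [[y y0 ->]|[u au bu]] := farkas_ord (fun i : 'I_#|J| => a (enum_val i)) b.
  left; exists (fun i => y (enum_rank i)) => //.
  rewrite [RHS](reindex _ (onW_bij _ (enum_val_bij J))) /=.
  by apply: eq_bigr => i _; rewrite enum_valK.
by right; exists u => // i; have := au (enum_rank i); rewrite enum_rankK.
Qed.

End Farkas.

Section Averages.
Variables (R : realFieldType) (I : finType).

Lemma average_ge (c v : I -> R) a : (forall i, 0 <= c i) -> \sum_i c i = 1 ->
  (forall i, c i != 0 -> a <= v i) -> a <= \sum_i c i * v i.
Proof.
move=> c0 c1 av; rewrite -[a]mul1r -c1 mulr_suml; apply: ler_sum => i _.
by have [->|ci] := eqVneq (c i) 0; rewrite ?mul0r // ler_wpM2l ?av.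
Qed.

Lemma average_le (c v : I -> R) a : (forall i, 0 <= c i) -> \sum_i c i = 1 ->
  (forall i, c i != 0 -> v i <= a) -> \sum_i c i * v i <= a.
Proof.
move=> c0 c1 va; rewrite -[a]mul1r -c1 mulr_suml; apply: ler_sum => i _.
by have [->|ci] := eqVneq (c i) 0; rewrite ?mul0r // ler_wpM2l ?va.
Qed.

Lemma average_support (c : I -> R) : \sum_i c i = 1 -> exists i, c i != 0.
Proof.
move=> c1; apply/existsP; apply: contraT => /existsPn none.
move: c1; rewrite big1 => [/esym/eqP|i _]; first by rewrite oner_eq0.
by apply/eqP/negbNE.
Qed.

(** An average that attains a lower bound of the values carrying weight only
    involves values equal to the bound. *)
Lemma average_min (c v : I -> R) a i : (forall i, 0 <= c i) -> \sum_i c i = 1 ->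
  (forall i, c i != 0 -> a <= v i) -> \sum_i c i * v i <= a -> c i != 0 -> v i = a.
Proof.
move=> c0 c1 av le ci; apply/eqP; rewrite -subr_eq0.
have : \sum_i c i * (v i - a) = 0.
  apply/eqP; rewrite eq_le sumr_ge0 ?andbT => [|j _].
    by under eq_bigr do rewrite mulrBr; rewrite sumrB -mulr_suml c1 mul1r subr_le0.
  by have [->|cj] := eqVneq (c j) 0; rewrite ?mul0r // mulr_ge0 // subr_ge0 av.
move=> /psumr_eq0P /(_ i isT) /eqP; rewrite mulf_eq0 (negbTE ci) //=; apply=> j _.
by have [->|cj] := eqVneq (c j) 0; rewrite ?mul0r // mulr_ge0 // subr_ge0 av.
Qed.

(** Finitely many strict inequalities persist under a small perturbation. *)
Lemma small_step (s t : I -> R) :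
  exists2 d, 0 < d & forall i, 0 < s i -> 0 < s i + d * t i.
Proof.
have : exists2 d, 0 < d & forall i, i \in enum I -> 0 < s i -> 0 < s i + d * t i.
  elim: (enum I) => [|i r [d d0 IH]]; first by exists 1.
  have [si|si] := lerP (s i) 0.
    by exists d => // j; rewrite inE => /predU1P[->|/IH //]; rewrite ltNge si.
  pose e := s i / (`|t i| + 1).
  have t1 : 0 < `|t i| + 1 by rewrite ltr_wpDl.
  have e0 : 0 < e by rewrite divr_gt0.
  exists (Num.min d e) => [|j]; first by rewrite lt_min d0.
  have [mn0 [md me]] : 0 < Num.min d e /\ (Num.min d e <= d /\ Num.min d e <= e).
    by rewrite lt_min d0 e0 !ge_min !lexx orbT.
  move: (Num.min d e) mn0 md me => f f0 fd fe.
  have bnd (x : R) : - `|x| <= x by rewrite lerNl -normrN ler_norm.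
  rewrite inE => /predU1P[-> _|jr sj].
    have : f * (`|t i| + 1) <= s i by rewrite -ler_pdivlMr.
    have : f * - `|t i| <= f * t i by rewrite ler_wpM2l // ltW.
    by move: si fe; lra.
  have h := IH j jr sj; have [tj|tj] := lerP 0 (t j).
    by rewrite ltr_wpDr // mulr_ge0 // ltW.
  by apply: lt_le_trans h _; rewrite lerD2l ler_wnM2r // ltW.
by move=> [d d0 h]; exists d => // i; apply: h; rewrite mem_enum.
Qed.

End Averages.

(** * Convex hulls of finite families *)

Section Hull.
Variables (R : realType) (m : nat) (I : finType) (q : I -> 'rV[R]_m).
Implicit Types (V : {set I}) (x : 'rV[R]_m) (u : 'cV[R]_m) (c : I -> R).

(** The convex hull of the points of [q] with index in [V]. *)
Definition hull V : set 'rV[R]_m := convex_hull (image [set` V] q).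

(** Regrouping the terms of a combination by the point that they involve. *)
Lemma sum_fiber (Z : lmodType R) (J : finType) (f : J -> I) (c : J -> R)
    (F : I -> Z) :
  \sum_i (\sum_(j | f j == i) c j) *: F i = \sum_j c j *: F (f j).
Proof.
rewrite [RHS](partition_big f predT) //=; apply: eq_bigr => i _.
by rewrite scaler_suml; apply: eq_bigr => j /eqP ->.
Qed.

Lemma hullP V x : hull V x <->
  exists c, [/\ forall i, 0 <= c i, forall i, i \notin V -> c i = 0,
                \sum_i c i = 1 & x = \sum_i c i *: q i].
Proof.
split=> [[k [p [c [pV c0 c1 ->]]]]|[c [c0 cV c1 ->]]].
  have {}pV i : exists j, j \in V /\ q j = p i by have [j jV e] := pV i; exists j.
  have [f fP] := fin_all_exists pV.
  exists (fun i => \sum_(j | f j == i) c j); split.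
  - by move=> i; apply: sumr_ge0.
  - move=> i iV; apply: big_pred0 => j; apply: contraNF iV => /eqP <-.
    by have [] := fP j.
  - by rewrite -c1 [RHS](partition_big f predT).
  - by rewrite sum_fiber; apply: eq_bigr => j _; have [_ ->] := fP j.
have sumV (Z : nmodType) (F : I -> Z) : (forall i, i \notin V -> F i = 0) ->
    \sum_i F i = \sum_(j < #|V|) F (enum_val j).
  move=> F0; rewrite -big_enum_val [LHS](bigID (mem V)) /= [X in _ + X]big1 ?addr0 //.
exists #|V|, (fun j => q (enum_val j)), (fun j : 'I_#|V| => c (enum_val j)).
split=> //.
- by move=> j; exists (enum_val j) => //=; exact: enum_valP.
- by rewrite -sumV.
- by rewrite sumV // => i /cV ->; rewrite scale0r.
Qed.

Lemma hull_mono V V' : V \subset V' -> (hull V `<=` hull V')%classic.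
Proof.
move=> /fintype.subsetP sub x /hullP[c [c0 cV c1 xE]]; apply/hullP.
by exists c; split=> // i iV'; apply: cV; apply: contra iV'; exact: sub.
Qed.

Lemma hull_point V i : i \in V -> hull V (q i).
Proof.
move=> iV; apply/hullP; exists (fun j => (j == i)%:R); split.
- by move=> j; rewrite ler0n.
- by move=> j; have [->|] := eqVneq j i; first by rewrite iV.
- by rewrite (bigD1 i) //= eqxx big1 ?addr0 // => j /negbTE ->.
- rewrite (bigD1 i) //= eqxx scale1r big1 ?addr0 // => j /negbTE ->.
  by rewrite scale0r.
Qed.

Lemma hull0 : hull finset.set0 = classical_sets.set0.
Proof.
rewrite -subset0 => x /hullP[c [_ c0 + _]].
rewrite big1 => [/esym/eqP|i _]; first by rewrite oner_eq0.
by apply: c0; rewrite inE.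
Qed.

(** The indices in [V] at whose point the functional [u] is minimal. *)
Definition argmin_in V u : {set I} :=
  [set i in V | [forall j in V, q i |* u <= q j |* u]].

Lemma argmin_hull V u : argmin_set u (hull V) = hull (argmin_in V u).
Proof.
apply/seteqP; split=> x.
  move=> [/hullP[c [c0 cV c1 xE]] xmin]; apply/hullP; exists c; split=> // i.
  apply: contraNeq => ci; rewrite inE.
  have ge j : j \in V -> x |* u <= q j |* u by move=> jV; apply/xmin/hull_point.
  have nV j : c j != 0 -> j \in V by move=> cj; apply: contraR cj => /cV ->.
  rewrite nV //=; apply/forall_inP => j jV.
  rewrite (@average_min _ _ c (fun j => q j |* u) (x |* u)) ?ge //.
    by move=> k /nV /ge.
  by rewrite xE ev_suml; apply: ler_sum => k _; rewrite evZl.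
move=> /hullP[c [c0 cV c1 xE]]; split.
  apply/hullP; exists c; split=> // i iV; apply: cV.
  by rewrite inE (negbTE iV).
move=> y /hullP[d [d0 dV d1 yE]].
have -> : y |* u = \sum_i d i * (q i |* u).
  by rewrite yE ev_suml; apply: eq_bigr => i _; rewrite evZl.
apply: average_ge => // j dj.
have jV : j \in V by apply: contraR dj => /dV ->.
have -> : x |* u = \sum_i c i * (q i |* u).
  by rewrite xE ev_suml; apply: eq_bigr => i _; rewrite evZl.
apply: average_le => // i ci.
have : i \in argmin_in V u by apply: contraR ci => /cV ->.
by rewrite inE => /andP[_ /forall_inP]; apply.
Qed.

(** Farkas' lemma for the vectors (q i, 1). *)
Lemma hull_separation V x : ~ hull V x ->
  exists u, forall i, i \in V -> x |* u < q i |* u.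
Proof.
move=> nx; pose a (i : {i | i \in V}) : 'rV[R]_(m + 1) := row_mx (q (val i)) 1%:M.
have [[y y0 yE]|[u au bu]] := farkas a (row_mx x 1%:M).
  have : row_mx x 1%:M = row_mx (\sum_i y i *: q (val i)) (\sum_i y i *: 1%:M).
    by rewrite yE -sum_row_mx; apply: eq_bigr => i _; rewrite scale_row_mx.
  move=> /eq_row_mx[xE /matrixP/(_ 0 0)]; rewrite summxE mxE => yE1.
  case: nx; apply/hullP; exists (fun i => \sum_(j | val j == i) y j); split.
  - by move=> i; apply: sumr_ge0.
  - move=> i iV; apply: big_pred0 => j; apply: contraNF iV => /eqP <-.
    exact: valP.
  - rewrite [RHS]yE1 [RHS](partition_big (fun j : {i | i \in V} => val j) predT) //=.
    apply: eq_bigr => i _; apply: eq_bigr => j _; by rewrite !mxE mulr1.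
  - by rewrite sum_fiber.
exists (- usubmx u) => i iV; rewrite !evNr ltrN2.
have ev_row (z : 'rV[R]_m) :
    row_mx z 1%:M |* u = z |* usubmx u + 1%:M |* dsubmx u.
  by rewrite -{1}[u]vsubmxK mul_row_col mxE.
have := au (Sub i iV); rewrite /a ev_row /= => ?.
rewrite ev_row in bu; rewrite -[_ < _](ltrD2r (1%:M |* dsubmx u)).
exact: le_lt_trans bu.
Qed.

End Hull.

Section Vertices.
Variables (R : realType) (m : nat) (I : finType) (q : I -> 'rV[R]_m).
Implicit Types (V : {set I}) (x : 'rV[R]_m) (u : 'cV[R]_m).

Lemma hull1 i : hull q [set i] = [set q i]%classic.
Proof.
apply/seteqP; split=> [x /hullP[c [_ c0 c1 ->]]|x -> /=]; last first.
  by apply: hull_point; rewrite inE.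
have z j : j != i -> c j = 0 by move=> ji; apply: c0; rewrite inE.
have ci : c i = 1 by rewrite -c1 (bigD1 i) //= big1 ?addr0.
rewrite (bigD1 i) //= ci scale1r big1 ?addr0 // => j /z ->.
by rewrite scale0r.
Qed.

Lemma hull_convex (J : finType) V (z : J -> 'rV[R]_m) (c : J -> R) :
  (forall j, 0 <= c j) -> \sum_j c j = 1 -> (forall j, c j != 0 -> hull q V (z j)) ->
  hull q V (\sum_j c j *: z j).
Proof.
move=> c0 c1 zV.
have /fin_all_exists[d dP] (j : J) : exists d : I -> R, c j != 0 ->
    [/\ forall i, 0 <= d i, forall i, i \notin V -> d i = 0,
        \sum_i d i = 1 & z j = \sum_i d i *: q i].
  have [_|cj] := boolP (c j == 0); first by exists (fun=> 0).
  by have /hullP[d dP] := zV j cj; exists d.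
apply/hullP; exists (fun i => \sum_j c j * d j i); split.
- move=> i; apply: sumr_ge0 => j _; have [->|cj] := eqVneq (c j) 0.
    by rewrite mul0r.
  by rewrite mulr_ge0 //; have [-> ] := dP j cj.
- move=> i iV; apply: big1 => j _; have [->|cj] := eqVneq (c j) 0.
    by rewrite mul0r.
  by have [_ -> // _ _] := dP j cj; rewrite mulr0.
- rewrite exchange_big -c1 /=; apply: eq_bigr => j _.
  have [->|cj] := eqVneq (c j) 0; first by rewrite big1 // => i _; rewrite mul0r.
  by rewrite -mulr_sumr; have [_ _ -> _] := dP j cj; rewrite mulr1.
- under [RHS]eq_bigr do rewrite scaler_suml.
  rewrite exchange_big /=; apply: eq_bigr => j _.
  have [->|cj] := eqVneq (c j) 0.
    by rewrite scale0r big1 // => i _; rewrite mul0r scale0r.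
  have [_ _ _ ->] := dP j cj; rewrite scaler_sumr; apply: eq_bigr => i _.
  by rewrite scalerA.
Qed.

Lemma hull_sub V V' : (forall i, i \in V -> hull q V' (q i)) ->
  (hull q V `<=` hull q V')%classic.
Proof.
move=> sub x /hullP[c [c0 cV c1 ->]]; apply: hull_convex => // i ci.
by apply: sub; apply: contraR ci => /cV ->.
Qed.

(** A generator that is not in the hull of the others is a vertex. *)
Lemma vertex_of_hull V i : i \in V -> ~ hull q (V :\ i) (q i) ->
  is_vertex (hull q V) (q i).
Proof.
move=> iV /hull_separation[u lt]; right; exists u.
rewrite argmin_hull -hull1; congr (hull q _); apply/setP => j; rewrite !inE.
apply/eqP/andP => [->|[jV /forall_inP/(_ i iV)]].
  split=> //; apply/forall_inP => k kV.
  by have [->//|ki] := eqVneq k i; apply/ltW/lt; rewrite !inE ki.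
by rewrite leNgt; apply: contraNeq => ji; apply: lt; rewrite !inE ji.
Qed.

Lemma hull_vertices V : exists V' : {set I}, [/\ V' \subset V, hull q V' = hull q V
  & forall i, i \in V' -> is_vertex (hull q V) (q i)].
Proof.
have [k] := ubnP #|V|; elim: k V => // k IH V Vk.
have [[i [iV hi]]|none] := pselect (exists i, i \in V /\ hull q (V :\ i) (q i)).
  have [|V' [V'V V'E vert]] := IH (V :\ i).
    by move: Vk; rewrite (cardsD1 i) iV.
  have E : hull q (V :\ i) = hull q V.
    apply/seteqP; split; first by apply: hull_mono; exact: subD1set.
    apply: hull_sub => j jV; have [->//|ji] := eqVneq j i.
    by apply: hull_point; rewrite !inE ji.
  exists V'; rewrite -E; split=> //.
  exact: fintype.subset_trans V'V (subD1set _ _).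
exists V; split=> // i iV; apply: vertex_of_hull => // hi.
by apply: none; exists i.
Qed.

Lemma vertex_hull_point V v : is_vertex (hull q V) v -> exists2 i, i \in V & q i = v.
Proof.
case=> [e|[u e]]; first by have : [set v]%classic v by []; rewrite e.
have /hullP[c [_ c0 c1 vE]] : hull q (argmin_in q V u) v by rewrite -argmin_hull -e.
have [i ci] := average_support c1.
have iA : i \in argmin_in q V u by apply: contraR ci => /c0 ->.
exists i; first by move: iA; rewrite inE => /andP[].
by have := hull_point q iA; rewrite -argmin_hull -e.
Qed.

End Vertices.

(** * The cells of a regular subdivision *)

Section Regular.
Variables (R : realType) (n : nat) (I : finType) (q : I -> 'rV[R]_n) (h : I -> R).
Hypothesis q_inj : injective q.
Implicit Types (w u : 'cV[R]_n) (x : 'rV[R]_n).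

(** The height tilted by the linear functional [w]. *)
Definition reduced w (i : I) : R := h i - q i |* w.

(** The indices of the points on the lower face in direction [w]. *)
Definition cell w : {set I} := [set i | [forall j, reduced w i <= reduced w j]].

(** The heights as a function on the ambient space, zero outside the family. *)
Definition point_height x : R := if [pick i | q i == x] is Some i then h i else 0.

Let lift i := lift_point point_height (q i).

Lemma point_heightE i : point_height (q i) = h i.
Proof.
rewrite /point_height; case: pickP => [j /eqP/q_inj -> //|/(_ i)].
by rewrite eqxx.
Qed.

Lemma cellP w i : reflect (forall j, reduced w i <= reduced w j) (i \in cell w).
Proof. by rewrite inE; apply: forallP. Qed.

Lemma ev_lift i (c : 'cV[R]_(n + 1)) :
  lift i |* c = q i |* usubmx c + h i * c (rshift n ord0) 0.
Proof.
rewrite /lift /lift_point point_heightE -{1}[c]vsubmxK mul_row_col mxE.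
by congr (_ + _); rewrite mul_scalar_mx !mxE.
Qed.

Lemma lsubmx_hull V : (@lsubmx R 1 n 1 @` hull lift V = hull q V)%classic.
Proof.
have lsum (c : I -> R) : lsubmx (\sum_i c i *: lift i) = \sum_i c i *: q i.
  by rewrite linear_sum; apply: eq_bigr => i _; rewrite linearZ /= row_mxKl.
apply/seteqP; split=> [_ [x /hullP[c [c0 cV c1 ->]] <-]|x /hullP[c [c0 cV c1 ->]]].
  by apply/hullP; exists c; split.
by exists (\sum_i c i *: lift i); first by apply/hullP; exists c.
Qed.

Lemma induced_cells : induced_subdivision (range q) point_height =
  [set T | T = set0 \/ exists w, T = hull q (cell w)]%classic.
Proof.
have liftE :
    (convex_hull (lift_point point_height @` range q) = hull lift [set: I])%classic.
  rewrite image_comp /hull; congr (convex_hull _); apply/seteqP; split=> _ [i _ <-];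
    by exists i => //; rewrite /= inE.
have argminE w (c : 'cV[R]_(n + 1)) : 0 < c (rshift n ord0) 0 ->
    usubmx c = - c (rshift n ord0) 0 *: w ->
    argmin_in lift [set: I] c = cell w.
  move=> c0 cw; apply/setP => i.
  have le j : (lift i |* c <= lift j |* c) = (reduced w i <= reduced w j).
    by rewrite !ev_lift cw !evZr -[RHS](ler_pM2l c0) /reduced; congr (_ <= _); ring.
  rewrite inE finset.in_setT /=; apply/forall_inP/cellP => imin j.
    by rewrite -le imin ?inE.
  by rewrite le imin.
rewrite /induced_subdivision liftE; apply/seteqP; split=> [_ [F + <-]|T].
  case=> [->|[c [c0 ->]]]; [by left; rewrite image_set0|right].
  exists (- (c (rshift n ord0) 0)^-1 *: usubmx c).
  rewrite argmin_hull lsubmx_hull.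
  rewrite (argminE (- (c (rshift n ord0) 0)^-1 *: usubmx c)) //.
  by rewrite scalerA mulrNN mulfV ?scale1r // gt_eqF.
case=> [->|[w ->]].
  by exists set0; [left|rewrite image_set0].
have c0 : col_mx (- w) 1%:M (rshift n ord0) 0 = 1 :> R by rewrite col_mxEd mxE.
exists (hull lift (cell w)); last exact: lsubmx_hull.
right; exists (col_mx (- w) 1%:M); rewrite c0 ltr01 argmin_hull.
by rewrite (argminE w) // ?c0 // col_mxKu scaleN1r.
Qed.

Lemma cell_nonempty w (i : I) : exists j, j \in cell w.
Proof.
have [j _ jmin] := arg_minP (reduced w) (erefl : xpredT i).
by exists j; apply/cellP => k; exact: jmin.
Qed.

Lemma reduced_sub w w' i : reduced w i - reduced w' i = q i |* (w' - w).
Proof. by rewrite /reduced evBr; ring. Qed.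

(** Tilting [w] slightly by [u] selects a face of the cell. *)
Lemma argmin_cell w u : exists w', argmin_in q (cell w) u = cell w'.
Proof.
pose gap (ij : I * I) := reduced w ij.2 - reduced w ij.1.
have [d d0 dP] := small_step gap (fun ij => q ij.2 |* u - q ij.1 |* u).
have rE i : reduced (w - d *: u) i = reduced w i + d * (q i |* u).
  by rewrite /reduced evBr evZr; ring.
exists (w - d *: u); apply/setP => i; apply/idP/cellP => [|imin].
  rewrite inE => /andP[/cellP iw /forall_inP iu] j; rewrite !rE.
  have := iw j; rewrite le_eqVlt => /predU1P[e|lt].
    have jw : j \in cell w by apply/cellP => k; rewrite -e.
    by rewrite e lerD2l ler_pM2l ?iu.
  have := dP (i, j); rewrite /gap /= subr_gt0 => /(_ lt); lra.
have [j jw] := cell_nonempty w i.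
have iw : i \in cell w.
  apply/cellP => k; apply: (@le_trans _ _ (reduced w j)); last exact/cellP.
  rewrite leNgt; apply/negP => lt.
  have := dP (j, i); rewrite /gap /= subr_gt0 => /(_ lt).
  by have := imin j; rewrite !rE; lra.
rewrite inE iw /=; apply/forall_inP => k kw.
have e : reduced w i = reduced w k.
  by apply/eqP; rewrite eq_le (cellP _ _ iw) (cellP _ _ kw).
by have := imin k; rewrite !rE e lerD2l ler_pM2l.
Qed.

(** If x is in both hulls, its two representations give the same average of the
    tilted heights, so each is supported on both cells. *)
Lemma hull_cellI w w' :
  (hull q (cell w) `&` hull q (cell w') = hull q (cell w :&: cell w'))%classic.
Proof.
apply/seteqP; split=> x; last first.
  by move=> xV; split; apply: hull_mono xV; [exact: subsetIl|exact: subsetIr].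
move=> [/hullP[c [c0 cV c1 xc]] /hullP[d [d0 dV d1 xd]]].
have cw i : c i != 0 -> i \in cell w by move=> ci; apply: contraR ci => /cV ->.
have dw i : d i != 0 -> i \in cell w' by move=> di; apply: contraR di => /dV ->.
have [j dj] := average_support d1; have [i ci] := average_support c1.
apply/hullP; exists c; split=> // k; apply: contraNeq => ck.
rewrite inE cw //=; apply/cellP => l.
have -> : reduced w' k = reduced w' j; last exact/cellP/dw.
apply: (average_min c0 c1 _ _ ck) => [i' _|]; first exact/cellP/dw.
have diff (e : I -> R) : \sum_i e i * reduced w' i - \sum_i e i * reduced w i =
    (\sum_i e i *: q i) |* (w - w').
  rewrite -sumrB ev_suml; apply: eq_bigr => i' _.
  by rewrite evZl -mulrBr reduced_sub.
have cmin : \sum_i c i * reduced w i <= \sum_i d i * reduced w i.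
  have low : \sum_k c k * reduced w k <= reduced w i.
    by apply: average_le => // i' ci'; apply: (cellP _ _ (cw _ ci')).
  apply: le_trans low _; apply: average_ge => // i' _.
  exact: (cellP _ _ (cw _ ci)).
have dmin : \sum_i d i * reduced w' i <= reduced w' j.
  by apply: average_le => // i' di'; apply: (cellP _ _ (dw _ di')).
have := diff c; have := diff d; rewrite -xc -xd => <- dc.
lra.
Qed.

Lemma argmin_cellI w w' k : k \in cell w :&: cell w' ->
  argmin_in q (cell w) (w - w') = cell w :&: cell w'.
Proof.
rewrite inE => /andP[kw kw']; apply/setP => i; rewrite !inE -/(cell w).
case iw: [forall j, _] => //=; have {}iw : i \in cell w by rewrite inE.
have const j : j \in cell w -> reduced w j = reduced w k.
  by move=> jw; apply/eqP; rewrite eq_le (cellP _ _ jw) (cellP _ _ kw).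
apply/forall_inP/forallP => [imin j|imin j jw]; last first.
  by rewrite -!reduced_sub (const i) // (const j) // lerD2r.
apply: le_trans (cellP _ _ kw' j); have := imin k kw.
by rewrite -!reduced_sub (const i) // lerD2r.
Qed.

Lemma face_cellI w w' :
  is_face (hull q (cell w)) (hull q (cell w) `&` hull q (cell w'))%classic.
Proof.
rewrite hull_cellI.
have [->|/set0Pn[k kV]] := eqVneq (cell w :&: cell w') finset.set0.
  by left; rewrite hull0.
by right; exists (w - w'); rewrite argmin_hull (argmin_cellI kV).
Qed.

End Regular.

Section Cover.
Variables (R : realType) (n : nat) (I : finType) (q : I -> 'rV[R]_n) (h : I -> R).
Implicit Types (w u : 'cV[R]_n) (x : 'rV[R]_n) (c : I -> R).

(** The vector (x, s, t). *)
Let vec x (s t : R) : 'rV[R]_(n + 1 + 1) := row_mx (row_mx x s%:M) t%:M.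

Let vec_sum (J : finType) (y : J -> R) (X : J -> 'rV[R]_n) (S T : J -> R) :
  \sum_j y j *: vec (X j) (S j) (T j) =
  vec (\sum_j y j *: X j) (\sum_j y j * S j) (\sum_j y j * T j).
Proof.
rewrite /vec (eq_bigr (fun j =>
  row_mx (row_mx (y j *: X j) (y j * S j)%:M) (y j * T j)%:M)).
  by rewrite !sum_row_mx -!raddf_sum.
by move=> j _; rewrite !scale_row_mx !scale_scalar_mx.
Qed.

Let vec_inj x s t x' s' t' : vec x s t = vec x' s' t' -> [/\ x = x', s = s' & t = t'].
Proof.
move=> /eq_row_mx[/eq_row_mx[-> /matrixP/(_ 0 0) sE] /matrixP/(_ 0 0) tE].
by move: sE tE; rewrite !mxE !eqxx !mulr1n.
Qed.

Let ev_vec x s t (u : 'cV[R]_(n + 1 + 1)) : vec x s t |* u =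
  x |* usubmx (usubmx u) + s * usubmx u (rshift n ord0) 0
  + t * u (rshift (n + 1) ord0) 0.
Proof.
rewrite /vec -{1}[u]vsubmxK -{1}[usubmx u]vsubmxK !mul_row_col !mul_scalar_mx.
by rewrite !mxE.
Qed.

(** The heights over x of the hull of the lifted points. *)
Definition heights x : set R := [set t | exists c,
  [/\ forall i, 0 <= c i, \sum_i c i = 1, x = \sum_i c i *: q i
    & t = \sum_i c i * h i]]%classic.

(** A lower bound on the heights over x is at most the value at x of some affine
    function that lies below all the lifted points: Farkas' lemma for the
    homogenized system. *)
Lemma dual_height x (t : R) : hull q [set: I] x ->
  (forall s, heights x s -> t <= s) ->
  exists w b, (forall i, q i |* w + b <= h i) /\ t <= x |* w + b.
Proof.
move=> xq tmin.
(* Nonnegative combinations of these vectors that equal (0, 0, -1) are, after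
   scaling, representations of x of height less than t. *)
pose a (j : I + bool) := match j with
  | inl i => vec (q i) 1 (h i)
  | inr true => vec (- x) (- 1) (- t)
  | inr false => vec 0 0 1 end.
have [[y y0]|[u au]] := farkas a (vec 0 0 (- 1)).
  rewrite big_sumType big_bool /=.
  rewrite (vec_sum (fun i => y (inl i)) q (fun=> 1) h) /vec.
  rewrite !scale_row_mx !add_row_mx !scale_scalar_mx -!raddfD /=.
  set mu := y (inr true); set s := y (inr false).
  move=> /vec_inj[xE sE tE].
  have yx : \sum_i y (inl i) *: q i = mu *: x.
    move: xE; rewrite scaler0 addr0 scalerN => /eqP.
    by rewrite eq_sym subr_eq0 => /eqP.
  have ymu : \sum_i y (inl i) = mu.
    move: sE; under eq_bigr do rewrite mulr1; lra.
  have yh : \sum_i y (inl i) * h i < mu * t.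
    by have := y0 (inr false); rewrite -/s; lra.
  have [mu0|mu0] := eqVneq mu 0.
    have z i : y (inl i) = 0.
      by move: ymu; rewrite mu0 => /psumr_eq0P; apply.
    by move: yh; rewrite mu0 mul0r big1 ?ltxx // => i _; rewrite z mul0r.
  have mup : 0 < mu by rewrite lt_neqAle eq_sym mu0 y0.
  have : t <= \sum_i y (inl i) / mu * h i.
    apply: tmin; exists (fun i => y (inl i) / mu); split=> //.
    - by move=> i; rewrite divr_ge0 ?y0 // ltW.
    - by rewrite -mulr_suml ymu divff.
    - rewrite (eq_bigr (fun i => mu^-1 *: (y (inl i) *: q i))) => [|i _].
        by rewrite -scaler_sumr yx scalerA mulVf // scale1r.
      by rewrite scalerA mulrC.
  rewrite (eq_bigr (fun i => y (inl i) * h i / mu)) => [|i _]; last by rewrite mulrAC.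
  by rewrite -mulr_suml ler_pdivlMr // mulrC leNgt yh.
set w0 := usubmx (usubmx u); set b0 := usubmx u (rshift n ord0) 0.
set g := u (rshift (n + 1) ord0) 0.
have ev0 : (0 : 'rV[R]_n) |* w0 = 0 by rewrite mul0mx mxE.
rewrite ev_vec -/w0 -/b0 -/g ev0 => g0.
have gneg : 0 < - g by lra.
exists ((- g)^-1 *: w0), ((- g)^-1 * b0); split=> [i|].
  rewrite evZr -mulrDr -(ler_pM2l gneg) mulrA divff ?gt_eqF // mul1r.
  by have := au (inl i); rewrite /a ev_vec -/w0 -/b0 -/g; lra.
rewrite evZr -mulrDr -(ler_pM2l gneg) mulrA divff ?gt_eqF // mul1r.
have := au (inr true); rewrite /a ev_vec -/w0 -/b0 -/g.
have -> : (- x) |* w0 = - (x |* w0) by rewrite mulNmx mxE.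
lra.
Qed.

(** The infimum of the heights over x is the value at x of an affine function
    (w, b) below all the lifted points; were x outside the hull of the points
    where it is tight, a separating functional would improve it. *)
Lemma cell_cover x : hull q [set: I] x -> exists w, hull q (cell q h w) x.
Proof.
move=> xq.
have ne : (heights x !=set0)%classic.
  have /hullP[c [c0 _ c1 xE]] := xq.
  by exists (\sum_i c i * h i); exists c.
have lb : has_lbound (heights x).
  exists (- \sum_i `|h i|) => _ [c [c0 c1 _ ->]]; apply: average_ge => // i _.
  rewrite lerNl (le_trans (ler_norm _)) // normrN (bigD1 i) //= lerDl.
  exact: sumr_ge0.
have [s hs|w [b [wh wx]]] := dual_height xq (t := inf (heights x)).
  exact: ge_inf.
pose Z := [set i | q i |* w + b == h i].
exists w; have ZV : Z \subset cell q h w.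
  apply/fintype.subsetP => i; rewrite inE => /eqP e; apply/cellP => j.
  by have := wh j; rewrite /reduced -e; lra.
apply: (hull_mono ZV); apply: contrapT => /hull_separation[u uZ].
have [d d0 dP] := small_step (fun i => h i - (q i |* w + b))
  (fun i => q i |* u - x |* u).
have slack i : 0 < h i - (q i |* w + b) + d * (q i |* u - x |* u).
  have [iZ|iZ] := boolP (i \in Z).
    have := uZ i iZ; move: iZ; rewrite inE => /eqP <-; rewrite subrr add0r -subr_gt0.
    exact: mulr_gt0.
  by apply: dP; rewrite subr_gt0 lt_neqAle wh andbT; move: iZ; rewrite inE.
have [e e0 eP] := small_step (fun i => h i - (q i |* w + b) + d * (q i |* u - x |* u))
  (fun=> -1).
suff : inf (heights x) + e <= inf (heights x) by rewrite gerDl leNgt e0.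
apply: lb_le_inf => // _ [c [c0 c1 xE ->]].
have : 0 <= \sum_i c i * (h i - (q i |* w + b) + d * (q i |* u - x |* u) + e * -1).
  by apply: average_ge => // i _; apply/ltW/eP.
have evx (v : 'cV[R]_n) : x |* v = \sum_i c i * (q i |* v).
  by rewrite xE ev_suml; apply: eq_bigr => i _; rewrite evZl.
have -> : \sum_i c i * (h i - (q i |* w + b) + d * (q i |* u - x |* u) + e * -1)
   = \sum_i c i * h i - (x |* w + b) - e.
  rewrite (eq_bigr (fun i => c i * h i - c i * (q i |* w) + d * (c i * (q i |* u))
    + c i * (- b - d * (x |* u) - e))) => [|i _]; last by ring.
  rewrite !big_split /= sumrN -mulr_sumr -!evx -mulr_suml c1; ring.
lra.
Qed.

End Cover.

Lemma cells_subdivision (R : realType) (n : nat) (I : finType) (q : I -> 'rV[R]_n)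
    (h : I -> R) :
  is_subdivision (hull q [set: I])
    [set T | T = set0 \/ exists w, T = hull q (cell q h w)]%classic.
Proof.
split.
- apply: (@sub_finite_set _ _ (range (hull q))).
    by move=> _ [->|[w ->]]; [exists finset.set0; rewrite ?hull0|exists (cell q h w)].
  exact/finite_image/finite_finset.
- have poly V : is_polytope (hull q V).
    by exists [set q i | i in [set` V]]%classic; split=> //; exact: finite_image.
  by move=> _ [->|[w ->]] //; rewrite -(hull0 q).
- apply/seteqP; split=> [x [_ [->|[w ->]]//]|x /(cell_cover h)[w xw]].
    by apply: hull_mono; exact: finset.subsetT.
  by exists (hull q (cell q h w)) => //; right; exists w.
- move=> _ F [->|[w ->]] [->|[c ->]]; try by left.
    by left; rewrite -subset0 => x [].
  by right; have [w' e] := argmin_cell q h w c; exists w'; rewrite argmin_hull e.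
- move=> _ _ [->|[w ->]] [->|[w' ->]]; rewrite ?set0I ?setI0; try by split; left.
  by split; [|rewrite setIC]; exact: face_cellI.
Qed.

(** * Unimodular simplices *)

Section Unimodular.
Variables (R : realType) (n : nat) (I : finType) (q : I -> 'rV[R]_n) (V : {set I}).
Hypothesis q_int : forall i, int_vector (q i).
Hypothesis V_lattice : forall c : I -> R, (forall i, i \notin V -> c i = 0) ->
  \sum_i c i \is a Num.int -> int_vector (\sum_i c i *: q i) ->
  forall i, c i \is a Num.int.
Implicit Types (c : I -> R).

(** A nontrivial relation could be scaled so that some coefficient is 1/2. *)
Lemma lattice_independent c : (forall i, i \notin V -> c i = 0) ->
  \sum_i c i = 0 -> \sum_i c i *: q i = 0 -> forall i, c i = 0.
Proof.
move=> cV c0 cq i; apply/eqP; apply: contraT => ci.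
have /(_ i) /intrP[z] : forall j, 2^-1 / c i * c j \is a Num.int.
  apply: V_lattice => [j /cV ->||j].
  - by rewrite mulr0.
  - by rewrite -mulr_sumr c0 mulr0 rpred0.
  - under eq_bigr do rewrite -scalerA.
    by rewrite -scaler_sumr cq scaler0 mxE rpred0.
rewrite divfK // => /(congr1 ( *%R 2)); rewrite divff ?pnatr_eq0 // => e.
suff : (1 : int) = 2 * z by lia.
by apply: (@intr_inj R); rewrite rmorphM.
Qed.

Lemma lattice_vertex i : i \in V -> is_vertex (hull q V) (q i).
Proof.
move=> iV; apply: vertex_of_hull => // /hullP[c [_ cV c1 qi]].
have ci : c i = 0 by apply: cV; rewrite !inE eqxx.
suff : c i - (i == i)%:R = 0.
  by rewrite ci eqxx sub0r => /eqP; rewrite oppr_eq0 oner_eq0.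
apply: (@lattice_independent (fun j => c j - (j == i)%:R)).
- move=> j jV; rewrite cV ?inE ?(negbTE jV) ?andbF // sub0r.
  by have [ji|_] := eqVneq j i; [rewrite ji iV in jV|rewrite oppr0].
- rewrite sumrB c1 (bigD1 i) //= eqxx big1 ?addr0 ?subrr // => j /negbTE -> //.
- under eq_bigr do rewrite scalerBl.
  rewrite sumrB -qi (bigD1 i) //= eqxx scale1r big1 ?addr0 ?subrr // => j /negbTE ->.
  by rewrite scale0r.
Qed.

Lemma lattice_simplex : is_simplex (hull q V).
Proof.
exists #|V|, (fun j => q (enum_val j)); split; last first.
  congr convex_hull; apply/seteqP; split=> _ [i iV <-].
    by exists (enum_rank_in iV i) => //; rewrite enum_rankK_in.
  by exists (enum_val i) => //; exact: enum_valP.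
move=> c c0 cq j.
pose b i := \sum_(k : 'I_#|V| | enum_val k == i) c k.
have <- : b (enum_val j) = c j.
  by apply: big_pred1 => k; rewrite (inj_eq enum_val_inj).
apply: lattice_independent.
- move=> i iV; apply: big_pred0 => k; apply: contraNF iV => /eqP <-.
  exact: enum_valP.
- by rewrite -[RHS]c0 [RHS](partition_big (fun k : 'I_#|V| => enum_val k) predT).
- by rewrite sum_fiber.
Qed.

Lemma affine_hull_weights x : affine_hull (hull q V) x ->
  exists c, [/\ forall i, i \notin V -> c i = 0, \sum_i c i = 1
              & x = \sum_i c i *: q i].
Proof.
move=> [k [p [a [pV a1 ->]]]].
have /fin_all_exists[c cP] (j : 'I_k) : exists c : I -> R,
    [/\ forall i, i \notin V -> c i = 0, \sum_i c i = 1 & p j = \sum_i c i *: q i].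
  by have /hullP[c [_ cV c1 pj]] := pV j; exists c.
exists (fun i => \sum_j a j * c j i); split.
- by move=> i iV; apply: big1 => j _; have [-> //] := cP j; rewrite mulr0.
- rewrite exchange_big -a1 /=; apply: eq_bigr => j _.
  by rewrite -mulr_sumr; have [_ -> _] := cP j; rewrite mulr1.
- under [RHS]eq_bigr do rewrite scaler_suml.
  rewrite exchange_big /=; apply: eq_bigr => j _.
  have [_ _ ->] := cP j; rewrite scaler_sumr; apply: eq_bigr => i _.
  by rewrite scalerA.
Qed.

Lemma sub_affine_hull (A : set 'rV[R]_n) : (A `<=` affine_hull A)%classic.
Proof.
move=> x Ax; exists 1%N, (fun=> x), (fun=> 1); split=> //.
  by rewrite big_ord1.
by rewrite big_ord1 scale1r.
Qed.

(** The edges of the simplex at one of its vertices. *)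
Lemma lattice_basis_of_point i0 : i0 \in V ->
  let B := [seq q i - q i0 | i <- enum (V :\ i0)] in
  maximal_independent (edge_vector (hull q V)) B /\
  lattice_basis (lin (hull q V) `&` @int_vector R n)%classic B.
Proof.
move=> i0V B; set s := enum (V :\ i0).
have sizeB : size B = size s by rewrite size_map.
have B_sum (a : I -> R) : \sum_(j < size B) a (nth i0 s j) *: B`_j =
    \sum_(i in V :\ i0) a i *: (q i - q i0).
  rewrite -(big_mkord xpredT (fun j => a (nth i0 s j) *: B`_j)) sizeB.
  rewrite -big_enum /= -/s (big_nth i0); apply: eq_big_nat => j /andP[_ js].
  by rewrite (nth_map i0).
have Bmem b : b \in B -> exists i, i \in V /\ b = q i - q i0.
  by move=> /mapP[i]; rewrite mem_enum !inE => /andP[_ iV] ->; exists i.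
have edge b : b \in B -> edge_vector (hull q V) b.
  by move=> /Bmem[i [iV ->]]; exists (q i), (q i0); split=> //; exact: lattice_vertex.
have diff_sum (c : I -> R) : (forall i, i \notin V -> c i = 0) -> \sum_i c i = 0 ->
    \sum_i c i *: q i = \sum_(i in V :\ i0) c i *: (q i - q i0).
  move=> cV c0.
  transitivity (\sum_i c i *: (q i - q i0)).
    under [RHS]eq_bigr do rewrite scalerBr.
    by rewrite sumrB -scaler_suml c0 scale0r subr0.
  rewrite (bigID (mem (V :\ i0))) /= [X in _ + X]big1 ?addr0 // => i.
  rewrite !inE negb_and negbK => /orP[/eqP ->|/cV ->]; first by rewrite subrr scaler0.
  by rewrite scale0r.
have freeB : free B.
  apply/(@freeP _ _ _ (in_tuple B)) => a /= aB j.
  pose f (j : 'I_(size B)) := nth i0 s j.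
  have f_inj : injective f.
    move=> k l /eqP; rewrite /f nth_uniq ?enum_uniq -?sizeB // => /eqP.
    exact: val_inj.
  have fV k : f k \in V :\ i0 by rewrite -mem_enum mem_nth // -sizeB.
  pose b i := \sum_(k | f k == i) a k.
  have bf k : b (f k) = a k by apply: big_pred1 => l; rewrite (inj_eq f_inj).
  pose c i := if i == i0 then - \sum_(i in V :\ i0) b i else b i.
  have b0 i : i \notin V :\ i0 -> b i = 0.
    by move=> iV; apply: big_pred0 => k; apply: contraNF iV => /eqP <-.
  have cV i : i \notin V -> c i = 0.
    move=> iV; rewrite /c; case: eqP => [e|_]; first by rewrite e i0V in iV.
    by apply: b0; rewrite !inE (negbTE iV) andbF.
  have csame i : i \in V :\ i0 -> c i = b i.
    by rewrite !inE /c => /andP[/negbTE ->].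
  have c0 : \sum_i c i = 0.
    rewrite (bigD1 i0) //= {1}/c eqxx addrC; apply/eqP; rewrite subr_eq0; apply/eqP.
    rewrite big_mkcond [RHS]big_mkcond; apply: eq_bigr => i _; rewrite !inE /c.
    have [//|ii0] := eqVneq i i0; case: ifPn => //= iV.
    by apply: b0; rewrite !inE (negbTE iV) andbF.
  rewrite -bf -csame //; apply: lattice_independent => //.
  rewrite diff_sum // (eq_bigr (fun i => b i *: (q i - q i0))) => [|i /csame -> //].
  rewrite -B_sum -[RHS]aB; apply: eq_bigr => k _.
  by rewrite -bf.
split; split=> //.
- move=> _ [u [v [/vertex_hull_point[i iV <-] /vertex_hull_point[j jV <-] ->]]].
  have span k : k \in V -> q k - q i0 \in <<B>>%VS.
    move=> kV; have [->|ki] := eqVneq k i0; first by rewrite subrr mem0v.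
    by apply/memv_span/mapP; exists k => //; rewrite mem_enum !inE ki.
  rewrite free_cons negb_and negbK.
  have -> : q i - q j = (q i - q i0) - (q j - q i0) by rewrite opprB addrA subrK.
  by rewrite memvB ?span.
- move=> _ /Bmem[i [iV ->]]; split; last by move=> k; rewrite !mxE rpredB ?q_int.
  by exists (q i); [|exists (q i0)] => //; apply/sub_affine_hull/hull_point.
- move=> _ [[u /affine_hull_weights[c [cV c1 ->]]
    [v /affine_hull_weights[d [dV d1 ->]] <-]]] zint.
  have zE : \sum_i c i *: q i - \sum_i d i *: q i = \sum_i (c i - d i) *: q i.
    by rewrite -sumrB; apply: eq_bigr => i _; rewrite scalerBl.
  have eV i : i \notin V -> c i - d i = 0 by move=> iV; rewrite cV ?dV ?subrr.
  have e0 : \sum_i (c i - d i) = 0 by rewrite sumrB c1 d1 subrr.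
  have eint i : c i - d i \is a Num.int.
    by apply: (V_lattice (c := fun i => c i - d i)); rewrite ?e0 ?rpred0 // -zE.
  exists (fun j => Num.floor (c (nth i0 s j) - d (nth i0 s j))).
  rewrite zE diff_sum // -B_sum; apply: eq_bigr => j _.
  by rewrite floorK.
Qed.

Lemma lattice_unimodular : unimodular_simplex (hull q V).
Proof.
split; first exact: lattice_simplex.
  by move=> v /vertex_hull_point[i _ <-].
have [V0|/set0Pn[i iV]] := eqVneq V finset.set0; last first.
  by exists [seq q j - q i | j <- enum (V :\ i)]; exact: lattice_basis_of_point.
have none v : ~ is_vertex (hull q V) v.
  by move=> /vertex_hull_point[i]; rewrite V0 inE.
exists [::]; split; split=> //; try by rewrite nil_free.
  by move=> w [u [v [/none]]].
move=> z [[u /affine_hull_weights[c [cV c1 _]] _] _]; exfalso; move: c1.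
by rewrite big1 => [/esym/eqP|i _]; rewrite ?oner_eq0 // cV ?V0 ?inE.
Qed.

End Unimodular.

(** * Base polytopes of submodular functions *)

Section BasePolytope.
Variables (R : realType) (n : nat) (f : {set 'I_n} -> R).
Hypothesis f_sub : submodular f.
Implicit Types (x y : 'rV[R]_n) (S T W : {set 'I_n}).

(** The generalized permutahedron defined by [f]. *)
Definition base_polytope : set 'rV[R]_n :=
  [set x | (forall S, \sum_(i in S) x 0 i <= f S) /\
           \sum_i x 0 i = f [set: 'I_n]]%classic.

(** The sum of the coordinates of x over [S]. *)
Definition xsum S x : R := \sum_(i in S) x 0 i.

Lemma xsumUI S T x : xsum (S :|: T) x + xsum (S :&: T) x = xsum S x + xsum T x.
Proof.
rewrite /xsum [X in X + _ = _]big_mkcond [X in _ + X = _]big_mkcond.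
rewrite [X in _ = X + _]big_mkcond [X in _ = _ + X]big_mkcond -!big_split.
apply: eq_bigr => i _ /=.
by rewrite !inE; case: (i \in S); case: (i \in T); rewrite //= ?addr0 ?add0r.
Qed.

Lemma xsumD S T x : xsum (S :\: T) x = xsum S x - xsum (S :&: T) x.
Proof. by rewrite /xsum [X in _ = X - _](big_setID T) /= addrAC subrr add0r. Qed.

(** The point [x + d (e_b - e_a)]. *)
Definition shift_point x (b a : 'I_n) (d : R) : 'rV[R]_n :=
  x + d *: (delta_mx 0 b - delta_mx 0 a).

Lemma xsum_shift S x b a d :
  xsum S (shift_point x b a d) = xsum S x + d * ((b \in S)%:R - (a \in S)%:R).
Proof.
rewrite /xsum -!sum_indicator -sumrB mulr_sumr -big_split; apply: eq_bigr => i _ /=.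
by rewrite !mxE !eqxx.
Qed.

(** The inequality of index [S] is an equality at x. *)
Definition tight x S : bool := xsum S x == f S.

Section Tight.
Variable x : 'rV[R]_n.
Hypothesis xP : base_polytope x.

Let xle S : xsum S x <= f S. Proof. exact: xP.1. Qed.

(** Tight sets form a lattice, by submodularity. *)
Lemma tightUI S T : tight x S -> tight x T -> tight x (S :|: T) && tight x (S :&: T).
Proof.
move=> /eqP eS /eqP eT; have := f_sub S T; rewrite -eS -eT -xsumUI => le.
have := xle (S :|: T); have := xle (S :&: T); rewrite /tight => l1 l2.
by apply/andP; split; rewrite eq_le xle /=; lra.
Qed.

Lemma tightT : tight x [set: 'I_n].
Proof.
by apply/eqP; case: xP => _ <-; apply: eq_bigl => i; rewrite inE.
Qed.

Lemma tight_bigcap (J : finType) (Q : pred J) (F : J -> {set 'I_n}) :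
  (forall j, Q j -> tight x (F j)) -> tight x (\bigcap_(j | Q j) F j).
Proof.
move=> FQ; elim/big_ind: _ => // [|S T tS tT]; first exact: tightT.
by have /andP[] := tightUI tS tT.
Qed.

(** A union of tight sets is tight unless it is empty; [f] need not vanish on the
    empty set. *)
Lemma tight_bigcup (J : finType) (Q : pred J) (F : J -> {set 'I_n}) :
  (forall j, Q j -> tight x (F j)) ->
  (\bigcup_(j | Q j) F j == finset.set0) || tight x (\bigcup_(j | Q j) F j).
Proof.
move=> FQ; elim/big_ind: _ => [|S T|j /FQ ->]; rewrite ?eqxx ?orbT //.
move=> /orP[/eqP ->|tS]; first by rewrite finset.set0U.
move=> /orP[/eqP ->|tT]; first by rewrite finset.setU0 tS orbT.
by have /andP[-> _] := tightUI tS tT; rewrite orbT.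
Qed.

Lemma shift_total b a d : \sum_i shift_point x b a d 0 i = f [set: 'I_n].
Proof.
have := xsum_shift [set: 'I_n] x b a d; rewrite !inE subrr mulr0 addr0.
have /eqP -> := tightT => <-.
by apply: eq_bigl => i; rewrite inE.
Qed.

(** A move is feasible for a small length unless blocked by a tight set. *)
Lemma small_shift b a : (forall T, tight x T -> b \in T -> a \in T) ->
  exists2 d, 0 < d & base_polytope (shift_point x b a d).
Proof.
move=> ba; have [d d0 dP] := small_step (fun T => f T - xsum T x)
  (fun T => (a \in T)%:R - (b \in T)%:R).
exists d => //; split; last exact: shift_total.
move=> T; rewrite -/(xsum T _) xsum_shift.
have [tT|ntT] := boolP (tight x T).
  rewrite (eqP tT) gerDl pmulr_rle0 // subr_le0 ler_nat.
  by have := ba T tT; case: (b \in T) => // ->.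
have : 0 < f T - xsum T x by rewrite subr_gt0 lt_neqAle xle andbT.
by move=> /dP; lra.
Qed.

Hypothesis x_int : int_vector x.
Hypothesis f_int : forall S, S != finset.set0 -> f S \is a Num.int.

Lemma unit_shift b a : (forall T, tight x T -> b \in T -> a \in T) ->
  base_polytope (shift_point x b a 1).
Proof.
move=> ba; split; last exact: shift_total.
move=> T; rewrite -/(xsum T _) xsum_shift mul1r.
have := ba T; have := xle T; case bT: (b \in T); case aT: (a \in T) => le tT.
- by rewrite subrr addr0.
- rewrite subr0; have sint : xsum T x \is a Num.int by exact: rpred_sum.
  have /f_int fint : T != finset.set0 by apply/set0Pn; exists b.
  have lt : xsum T x < f T.
    by rewrite lt_neqAle le andbT; apply/negP => /tT /(_ isT).
  move: sint fint lt => /intrP[z ->] /intrP[t ->].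
  by rewrite ltr_int -lezD1 -(ler_int R) rmorphD.
- by rewrite sub0r (le_trans _ le) // gerDl oppr_le0.
- by rewrite subrr addr0.
Qed.

End Tight.

(** [T] is the largest x-tight set without i and [W] the smallest y-tight set
    with i.  The moves by j are feasible when j is in [W] but not in [T], and
    submodularity applied to [W] and [T] gives such a j with [x_j < y_j]. *)
Lemma base_exchange x y i : base_polytope x -> base_polytope y ->
  int_vector x -> int_vector y ->
  (forall S, S != finset.set0 -> f S \is a Num.int) -> y 0 i < x 0 i ->
  exists j, [/\ x 0 j < y 0 j, base_polytope (shift_point x j i 1)
             & base_polytope (shift_point y i j 1)].
Proof.
move=> xP yP xint yint fint lti.
pose T := \bigcup_(S : {set 'I_n} | tight x S && (i \notin S)) S.
pose W := \bigcap_(S : {set 'I_n} | tight y S && (i \in S)) S.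
have tW : tight y W by apply: tight_bigcap => // S /andP[].
have tT : (T == finset.set0) || tight x T by apply: tight_bigcup => // S /andP[].
have iW : i \in W by apply/bigcapP => S /andP[].
have iT : i \notin T by apply/bigcupP => -[S /andP[_ /negP]].
have [j /andP[jWT ltj]|none] := pickP (fun j => (j \in W :\: T) && (x 0 j < y 0 j)).
  move: jWT; rewrite inE => /andP[jT jW]; exists j; split=> //.
    apply: unit_shift => // S tS jS; apply: contraNT jT => iS.
    by apply/bigcupP; exists S => //; rewrite tS.
  apply: unit_shift => // S tS iS.
  by move/bigcapP: jW => /(_ S); rewrite tS iS; apply.
have lt : xsum (W :\: T) y < xsum (W :\: T) x.
  rewrite /xsum !(bigD1 i (P := mem (W :\: T))) /= ?inE ?iW ?iT //.
  apply: ltr_leD => //; apply: ler_sum => j /andP[jWT _].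
  by move: (none j); rewrite /= jWT /= => /negbT; rewrite -leNgt.
have xle S : xsum S x <= f S by exact: xP.1.
have yle S : xsum S y <= f S by exact: yP.1.
move: lt; case/orP: tT => [/eqP ->|/eqP tT].
  by rewrite finset.setD0 (eqP tW) ltNge xle.
rewrite ltNge => /negP[]; rewrite !xsumD (eqP tW).
have := xsumUI W T x; rewrite tT.
by have := f_sub W T; have := xle (W :|: T); have := yle (W :&: T); lra.
Qed.

(** For b in [S], the smallest tight set containing b stays inside [S], otherwise
    some move would increase the sum over [S]. *)
Lemma tight_of_maximal x S : base_polytope x -> S != finset.set0 ->
  (forall y, base_polytope y -> xsum S y <= xsum S x) -> tight x S.
Proof.
move=> xP S0 xmax.
pose F b := \bigcap_(T : {set 'I_n} | tight x T && (b \in T)) T.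
have FS b : b \in S -> F b \subset S.
  move=> bS; apply/fintype.subsetP => a; apply: contraLR => aS.
  apply/negP => /bigcapP aF.
  have [|d d0 /xmax] := @small_shift x xP b a.
    by move=> T tT bT; apply: aF; rewrite tT bT.
  by rewrite xsum_shift bS (negbTE aS) subr0 mulr1 gerDl leNgt d0.
have SE : \bigcup_(b in S) F b = S.
  apply/setP => a; apply/bigcupP/idP => [[b bS]|aS].
    by move: a; apply/fintype.subsetP/FS.
  by exists a => //; apply/bigcapP => T /andP[].
have := @tight_bigcup x xP 'I_n (mem S) F.
rewrite SE (negbTE S0) /=; apply=> b _.
by apply: tight_bigcap => // T /andP[].
Qed.

(** The right-hand sides that matter are attained at an integer point. *)
Lemma base_integral x (I : finType) (q : I -> 'rV[R]_n) : base_polytope x ->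
  base_polytope = hull q [set: I] -> (forall i, int_vector (q i)) ->
  forall S, S != finset.set0 -> f S \is a Num.int.
Proof.
move=> xP PE qint S S0.
have [i0 _] : exists i : I, true.
  move: xP; rewrite PE => /hullP[c [_ _ c1 _]].
  by have [i _] := average_support c1; exists i.
have [i _ imax] := arg_maxP (fun i => xsum S (q i)) (erefl : xpredT i0).
have qP : base_polytope (q i) by rewrite PE; apply: hull_point; rewrite inE.
suff /eqP <- : tight (q i) S by apply: rpred_sum => k _; exact: qint.
apply: tight_of_maximal => // y; rewrite PE => /hullP[c [c0 _ c1 ->]].
have -> : xsum S (\sum_j c j *: q j) = \sum_j c j * xsum S (q j).
  rewrite /xsum; under eq_bigr do rewrite summxE.
  rewrite exchange_big; apply: eq_bigr => j _ /=; rewrite mulr_sumr.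
  by apply: eq_bigr => k _; rewrite mxE.
by apply: average_le => // j _; exact: imax.
Qed.

(** The coordinates are bounded by values of [f]. *)
Lemma finite_lattice_points : finite_set (base_polytope `&` @int_vector R n)%classic.
Proof.
pose C := \sum_S `|f S|; pose K := Num.bound (C + C).
have C0 : 0 <= C by exact: sumr_ge0.
have fC S : `|f S| <= C by rewrite /C (bigD1 S) //= lerDl sumr_ge0.
have xK x a : base_polytope x -> `|x 0 a| < K%:R.
  move=> xP; apply: le_lt_trans (archi_boundP (addr_ge0 C0 C0)).
  have xle S : xsum S x <= f S by exact: xP.1.
  have x1 : xsum [set a] x = x 0 a by rewrite /xsum big_set1.
  have xc : xsum (~: [set a]) x = f [set: 'I_n] - x 0 a.
    have x0 : xsum finset.set0 x = 0 by rewrite /xsum big_set0.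
    have := xsumUI [set a] (~: [set a]) x.
    rewrite finset.setUCr finset.setICr (eqP (tightT xP)) x1 x0; lra.
  have := xle [set a]; have := xle (~: [set a]); rewrite x1 xc.
  have := fC [set a]; have := fC (~: [set a]); have := fC [set: 'I_n].
  rewrite !ler_norml => /andP[? ?] /andP[? ?] /andP[? ?] ? ?.
  by apply/andP; split; lra.
pose g (phi : {ffun 'I_n -> 'I_(K + K).+1}) : 'rV[R]_n := \row_a ((phi a)%:R - K%:R).
apply: (@sub_finite_set _ _ (range g)); last exact: finite_image.
move=> x [xP xint].
pose phi : {ffun 'I_n -> 'I_(K + K).+1} :=
  [ffun a => inord (absz (Num.floor (x 0 a) + K%:Z))].
exists phi => //; rewrite /g /phi.
apply/rowP => a; rewrite !mxE ffunE.
have := xK x a xP; have /intrP[z ->] := xint a; rewrite intrKfloor.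
rewrite -(intr_norm R) -[K%:R]/(K%:Z%:~R) ltr_int => zK.
rewrite inordK; last by lia.
rewrite !pmulrn -rmorphB /=; congr (_%:~R); lia.
Qed.

End BasePolytope.

(** * The triangulation *)

(** An integral polytope is the hull of finitely many integer points, namely of
    its vertices. *)
Lemma integral_polytope_hull (R : realType) (n : nat) (P : set 'rV[R]_n) :
  is_polytope P -> integral_polytope P ->
  exists (I : finType) (q : I -> 'rV[R]_n),
    P = hull q [set: I] /\ forall i, int_vector (q i).
Proof.
move=> [A [/finite_seqP[X ->] PE]] Pint.
pose q0 (i : seq_sub X) := val i.
have P0 : P = hull q0 [set: seq_sub X].
  rewrite PE; congr convex_hull; apply/seteqP; split=> [x xX|_ [i _ <-]].
    by exists (SeqSub xX); rewrite //= inE.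
  exact: ssvalP.
have [V [_ VE vert]] := hull_vertices q0 [set: seq_sub X].
exists {i | i \in V}, (fun i => q0 (val i)); split; last first.
  by move=> i; apply: Pint; rewrite P0; apply/vert/valP.
rewrite P0 -VE; congr convex_hull; apply/seteqP; split=> [_ [i iV <-]|_ [i _ <-]].
  by exists (exist _ i iV); rewrite //= inE.
by exists (val i) => //; exact: valP.
Qed.

Theorem corollary3p6 (R : realType) (n : nat) (P : set 'rV[R]_n) :
  generalized_permutahedron P -> integral_polytope P ->
  exists S : set (set 'rV[R]_n), unimodular_triangulation P S /\ is_regular P S.
Proof.
move=> [polyP [f [f_sub PE]]] Pint.
have {}PE : P = base_polytope f by [].
have [J [r [Pr rint]]] := integral_polytope_hull polyP Pint.
have /finite_seqP[X XE] := finite_lattice_points f.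
have inX x : (x \in X) <-> P x /\ int_vector x.
  by rewrite PE; split => h; [have : [set` X]%classic x by []; rewrite -XE
    |have : (base_polytope f `&` @int_vector R n)%classic x by []; rewrite XE].
(* The family q lists all the lattice points of P, and not only its vertices:
   the exchange property needs the other ones. *)
pose q (i : seq_sub X) : 'rV[R]_n := val i.
have qP i : P (q i) by apply: ((inX _).1 _).1; exact: ssvalP.
have qint i : int_vector (q i) by apply: ((inX _).1 _).2; exact: ssvalP.
have q_inj : injective q by exact: val_inj.
have Pq : P = hull q [set: seq_sub X].
  apply/seteqP; split=> x; rewrite Pr => /hullP[c [c0 cV c1 ->]]; last first.
    rewrite -Pr Pr; apply: hull_convex => // i _.
    by rewrite -Pr; exact: qP.
  apply: hull_convex => // j _.
  have jX : r j \in X.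
    by apply/inX; split => //; rewrite Pr; apply: hull_point; rewrite inE.
  by have := @hull_point _ _ _ q [set: seq_sub X] (SeqSub jX); apply; rewrite inE.
pose p (i : seq_sub X) (a : 'I_n) : int := Num.floor (q i 0 a).
have pE i a : (p i a)%:~R = q i 0 a by rewrite /p floorK ?qint.
have p_inj x y : p x =1 p y -> x = y.
  by move=> xy; apply/q_inj/rowP => a; rewrite -!pE xy.
have ex : exchange_property p.
  move=> x y i; rewrite -(ltr_int R) !pE => lt.
  have bP z : base_polytope f (q z) by rewrite -PE.
  have fint S : S != finset.set0 -> f S \is a Num.int.
    by apply: (@base_integral _ _ f f_sub _ _ r (bP x)); rewrite // -Pr -PE.
  have [j [ltj xP yP]] := base_exchange f_sub (bP x) (bP y) (qint x) (qint y) fint lt.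
  have shift_int z b a : int_vector (shift_point (q z) b a 1).
    by move=> k; rewrite !mxE rpredD ?qint // mul1r rpredB ?natr_int.
  have lift z b a : base_polytope f (shift_point (q z) b a 1) ->
      exists z', shifted p z b a z'.
    rewrite -PE => zP; have zX : shift_point (q z) b a 1 \in X by apply/inX.
    exists (SeqSub zX) => k; apply: (@intr_inj R).
    by rewrite pE rmorphB rmorphD /= pE !mulrz_nat !mxE !eqxx mul1r addrA.
  have [x' sx] := lift x j i xP; have [y' sy] := lift y i j yP.
  by exists j, x', y'; split=> //; rewrite -(ltr_int R) !pE.
have [h hP] := @unimodular_height _ _ p R ex p_inj.
have cell_lattice w (c : seq_sub X -> R) :
    (forall i, i \notin cell q h w -> c i = 0) ->
    \sum_i c i \is a Num.int -> int_vector (\sum_i c i *: q i) ->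
    forall i, c i \is a Num.int.
  move=> cV cint cqint; apply: (hP (fun a => w a 0)) => // [x y lt|a].
    apply: cV; apply/negP => /cellP/(_ y); rewrite leNgt => /negP[].
    have dotE z : q z |* w = dot p (fun a => w a 0) z.
      by rewrite mxE; apply: eq_bigr => a _; rewrite pE mulrC.
    by rewrite /reduced !dotE.
  have := cqint a; rewrite summxE; congr (_ \is a _).
  by apply: eq_bigr => i _; rewrite mxE pE.
exists (induced_subdivision (range q) (point_height q h)); split; last first.
  exists (range q), (point_height q h); split=> //.
  - exact/finite_image/finite_finset.
  - by move=> _ [i _ <-].
  - move=> v vP; have vX : v \in X.
      apply/inX; split; last exact: Pint.
      case: vP => [e|[c e]]; first by have : [set v]%classic v by []; rewrite e.
      by have : [set v]%classic v by []; rewrite e => -[].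
    by exists (SeqSub vX).
have unimod T : induced_subdivision (range q) (point_height q h) T ->
    unimodular_simplex T.
  rewrite induced_cells // => -[->|[w ->]].
    rewrite -(hull0 q); apply: lattice_unimodular => // c cV _ _ i.
    by rewrite cV ?inE ?rpred0.
  by apply: lattice_unimodular => // c; exact: cell_lattice.
split=> //; split; last by move=> T /unimod[].
by rewrite Pq induced_cells //; exact: cells_subdivision.
Qed.
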